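(* Let $C$ be a longest cycle in a graph $G$ of order $n$ and $\lambda$ a positive integer with $1\le\lambda\le\delta$. If $\kappa\geq \min\{\lambda,\delta-\lambda+1\}$ and $\delta\geq \frac{n+2}{\lambda+1}+\lambda-2$, then $\overline{c}\le\delta-\lambda$.
   Context: All graphs are finite, undirected, without loops or multiple edges. For a graph $G$ on $n$ vertices, $\delta$ denotes its minimum degree and $\kappa$ its connectivity. A cycle of order $t$ is a sequence $v_1\dots v_tv_1$ of distinct vertices with consecutive vertices adjacent; a single vertex is a cycle of order 1 and an edge a cycle of order 2. $C$ is a longest cycle of $G$, $c=|C|$ is the circumference, and $\overline{c}$ denotes the order of a longest cycle in $G-C$ (the subgraph obtained by deleting the vertices of $C$); $\overline{c}\le 0$ if $G-C$ is empty. *)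

(* Defs.v *)
From HB Require Import structures.
From mathcomp Require Import all_boot all_order all_algebra.

Set Implicit Arguments.
Unset Strict Implicit.
Unset Printing Implicit Defensive.

Record sgraph := SGraph {
  vertex :> finType;
  adj : rel vertex;
  adj_sym : symmetric adj;
  adj_irr : irreflexive adj
}.

Section DelVertices.
Variables (G : sgraph) (S : {set G}).

Definition del_adj : rel {x : G | x \notin S} :=
  fun x y => adj (val x) (val y).

Lemma del_adj_sym : symmetric del_adj.
Proof. by move=> x y; apply: adj_sym. Qed.

Lemma del_adj_irr : irreflexive del_adj.
Proof. by move=> x; apply: adj_irr. Qed.

Definition del_vertices : sgraph := SGraph del_adj_sym del_adj_irr.

End DelVertices.

Definition degree (G : sgraph) (x : G) : nat := #|[set y | adj x y]|.

(* The default #|G| exceeds every degree, so it matters only for the null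
   graph, whose minimum degree is set to 0. *)
Definition min_degree (G : sgraph) : nat := \big[minn/#|G|]_(x : G) degree x.

Definition connected (G : sgraph) : bool :=
  [forall x : G, forall y : G, connect (@adj G) x y].

(* Least number of vertices whose deletion leaves a disconnected graph or at
   most one vertex, so that a complete graph on n > 0 vertices has connectivity
   n - 1. The default #|G| is the size of S = [set: G], which is admissible. *)
Definition connectivity (G : sgraph) : nat :=
  \big[minn/#|G|]_(S : {set G} | ~~ connected (del_vertices S)
                                 || (#|del_vertices S| <= 1)) #|S|.

(* For s = [:: x] the path condition [cycle] would ask for a loop at x, hence
   the separate case; for s = [:: x; y] it says that xy is an edge. *)
Definition is_cycle (G : sgraph) (s : seq G) : bool :=
  (size s == 1) || [&& 1 < size s, uniq s & cycle (@adj G) s].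

Definition is_longest_cycle (G : sgraph) (C : seq G) : Prop :=
  is_cycle C /\ forall D : seq G, is_cycle D -> size D <= size C.

(* Order of a longest cycle; 0 for the null graph. Cycles have distinct
   vertices, so their orders are at most #|G|. *)
Definition circumference (G : sgraph) : nat :=
  \max_(k < #|G|.+1 | [exists s : k.-tuple G, is_cycle s]) k.

(* Main.v *)
Require Import Defs.
From mathcomp Require Import all_boot all_order all_algebra.
From mathcomp Require Import zify.
From Stdlib Require Import Classical.

(** Put k = min (lambda, delta - lambda + 1) and m = max (lambda, delta - lambda + 1),
    so that k + m = delta + 1 and the degree condition reads n + 2 <= (k + 1)(m + 1).
    Then every cycle off the longest cycle C has order less than k, as follows.
    Let D be a longest cycle of G - C, of order r >= k.

    If k = 1, or if r is at least 2k - 2 and k + 1, enlarge V(D) to a maximal set U off C any two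
    vertices of which are joined in U by a path on at least k vertices. By maximality
    each vertex off C and U hangs on U at a single vertex, so k-connectivity and Konig's
    theorem give k disjoint connections from U to vertices p_1, ..., p_k of C. Rerouting
    C through U shows that the successors of the p_i, together with a further vertex
    of U, have degree sum less than n + k(k - 1); hence n + 1 >= (k + 1)(m + 1).

    If r is smaller, let disjoint paths off C and D leave the vertices of D, first as
    many nontrivial ones as possible, then as long as possible, always leaving enough
    room for k disjoint connections of D to the rest of the graph. Since D is a longest
    cycle of G - C, the r tips of these paths have on average at most r - 1 neighbours
    off C (up to an excess paid for by the vertices on the paths), hence at least
    delta - r + 1 on C. Two tips starting at distance t on D are joined off C by a path
    on at least r - t + 1 vertices, so consecutive neighbours of tips on C are far
    apart; summing these gaps around C bounds its length from below. *)

Set Implicit Arguments.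
Unset Strict Implicit.
Unset Printing Implicit Defensive.

(** * Matchings and walks *)

(** The case of small r splits again. It is reached with r = k or with r + 3 <= 2k. If r <= m,
    averaging the gaps around C gives n + 1 >= (r + 1)(m + k - r + 1), which exceeds (k + 1)(m + 1)
    by (r - k)(m - r). For r > m this difference is negative, so the average is too weak. The
    obstacle is a pair of consecutive attached vertices of C that both see one and the same tip and
    no other: they may be only 2 apart, while every other gap has length above r / 2. Connectivity
    limits how often this happens. Distinct vertices of C that represent distinct tips force gaps of
    the other kind, and each of these carries a surplus. Where k representatives cannot be found,
    tips of long paths make up the number, and the vertices on these paths pay the same surplus.
    Together this yields 2(n + 1) >= (r + 1)(m + 2k - r + 2), which suffices as long as r stays
    below 2k. *)

Definition gorder (G : sgraph) : nat := #|G|.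

Lemma exists_maxP (P : nat -> Prop) (B : nat) :
  (exists n, P n) -> (forall n, P n -> n <= B) ->
  exists2 n, P n & forall m, P m -> m <= n.
Proof.
move=> [n0 Pn0] PB; move: {2}(B - n0) (leqnn (B - n0)) => d.
elim: d n0 Pn0 => [|d IH] n0 Pn0 led.
  exists n0 => // m /PB; have := PB _ Pn0; lia.
case: (classic (exists2 m, P m & n0 < m)) => [[m Pm ltm]|noP].
  by apply: (IH m) => //; lia.
exists n0 => // m Pm; rewrite leqNgt; apply/negP => lt; apply: noP; by exists m.
Qed.

Lemma card_le_inj (T : finType) (A : {set T}) (g : T -> nat) (n : nat) :
  {in A, forall x, g x < n} -> {in A &, injective g} -> #|A| <= n.
Proof.
move=> gn gi; case: n gn => [|n] gn.
  case: (set_0Vmem A) => [->|[x /gn]]; by rewrite ?cards0.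
have inj' : {in A &, injective (fun x => inord (g x) : 'I_n.+1)}.
  move=> x y xA yA /(congr1 val) /=; rewrite !inordK ?gn //; exact: gi.
by rewrite -(card_in_imset inj') -[X in _ <= X]card_ord max_card.
Qed.

Section Konig.
Variables (L R : finType).
Implicit Types (E M : {set L * R}) (A : {set L}) (B : {set R}).

Definition edge_cover E A B :=
  forall e, e \in E -> e.1 \in A \/ e.2 \in B.

Definition is_matching M :=
  forall e e', e \in M -> e' \in M -> e.1 = e'.1 \/ e.2 = e'.2 -> e = e'.

(* Uncrossing two small covers of E minus e and E minus e', for two edges with
   a common endpoint, yields a small cover of E; so an edge-critical E is itself
   a matching. *)
Theorem konig E k :
  (forall A B, edge_cover E A B -> k <= #|A| + #|B|) ->
  exists2 M : {set L * R}, M \subset E & is_matching M /\ k <= #|M|.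
Proof.
(* Two covers below [k] have total size at most 2k - 2. Uncrossing keeps the total, and adding the
   common endpoint to one of the new covers (the term [d]) raises it to at most 2k - 1, so one of
   the two is again below [k]. *)
have arith i1 u1 i2 u2 a a' b b' (d : bool) : i1 + u1 = a + a' -> i2 + u2 = b + b' ->
    a + b < k -> a' + b' < k -> k <= i1 + u2 -> k <= d + u1 + i2 -> False.
  by case: d; lia.
move: {2}#|E| (leqnn #|E|) => n; elim: n E => [|n IH] E.
  rewrite leqn0 cards_eq0 => /eqP-> cov; exists set0 => //; split.
    by move=> e e'; rewrite inE.
  rewrite cards0; have := cov set0 set0; rewrite !cards0; apply.
  by move=> e; rewrite inE.
move=> leE cov.
case: (classic (exists2 e, e \in E &
  forall A B, edge_cover (E :\ e) A B -> k <= #|A| + #|B|)).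
  move=> [e eE /IH [|M sM HM]]; first by move: leE; rewrite (cardsD1 e E) eE.
  by exists M => //; apply: subset_trans sM _; apply: subD1set.
move=> noe.
have crit e : e \in E -> exists A, exists2 B, edge_cover (E :\ e) A B & #|A| + #|B| < k.
  move=> eE; apply: NNPP => H; apply: noe; exists e => // A B c.
  by rewrite leqNgt; apply/negP => lt; apply: H; exists A; exists B.
have sub A B A' B' : #|A :&: A'| + #|A :|: A'| = #|A| + #|A'| /\
   #|B :&: B'| + #|B :|: B'| = #|B| + #|B'|.
  by split; rewrite addnC cardsUI.
have ncov e A B : e \in E -> edge_cover (E :\ e) A B -> #|A| + #|B| < k ->
    e.1 \notin A /\ e.2 \notin B.
  move=> eE c lt; suff H : ~ (e.1 \in A \/ e.2 \in B).
    by split; apply/negP => ?; apply: H; [left|right].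
  move=> ee; have : k <= #|A| + #|B|.
    apply: cov => f fE; case: (eqVneq f e) => [->//|ne]; apply: c; by rewrite !inE ne.
  lia.
exists E => //; split.
  move=> e f eE fE ef; apply/eqP/negPn/negP => nef.
  have [A [B cA lA]] := crit _ eE; have [A' [B' cA' lA']] := crit _ fE.
  have [e1 e2] := ncov _ _ _ eE cA lA; have [f1 f2] := ncov _ _ _ fE cA' lA'.
  have eA' : e.1 \in A' \/ e.2 \in B' by apply: cA'; rewrite !inE nef.
  have fA : f.1 \in A \/ f.2 \in B by apply: cA; rewrite !inE eq_sym nef.
  have [s1 s2] := sub A B A' B'.
  have in3 g : g \in E -> g = e \/ g = f \/ ((g.1 \in A \/ g.2 \in B) /\ (g.1 \in A' \/ g.2 \in B')).
    move=> gE; case: (eqVneq g e) => [|ne]; first by left.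
    case: (eqVneq g f) => [|nf]; first by right; left.
    by right; right; split; [apply: cA|apply: cA']; rewrite !inE ?ne ?nf.
  case: ef => ef.
  - have fB : f.2 \in B by case: fA => //; rewrite -ef (negbTE e1).
    have eB : e.2 \in B' by case: eA' => //; rewrite ef (negbTE f1).
    have c1 : edge_cover E (A :&: A') (B :|: B').
      move=> g /in3 [->|[->|[[a|b] [a'|b']]]]; rewrite !inE ?eB ?fB ?orbT; auto.
      + by rewrite a a'; left.
      + by rewrite b'; right; rewrite orbT.
      + by rewrite b; right.
      + by rewrite b; right.
    have c2 : edge_cover E (e.1 |: (A :|: A')) (B :&: B').
      move=> g /in3 [->|[->|[[a|b] [a'|b']]]]; rewrite !inE ?eqxx; auto.
      + by rewrite ef eqxx; left.
      + by rewrite a; left; rewrite orbT.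
      + by rewrite a; left; rewrite orbT.
      + by rewrite a'; left; rewrite !orbT.
      + by rewrite b b'; right.
    move: (cov _ _ c2); rewrite cardsU1; exact: (arith _ _ _ _ _ _ _ _ _ s1 s2 lA lA' (cov _ _ c1)).
  - have fB : f.1 \in A by case: fA => //; rewrite -ef (negbTE e2).
    have eB : e.1 \in A' by case: eA' => //; rewrite ef (negbTE f2).
    have c1 : edge_cover E (A :|: A') (B :&: B').
      move=> g /in3 [->|[->|[[a|b] [a'|b']]]]; rewrite !inE ?eB ?fB ?orbT; auto.
      + by rewrite a; left.
      + by rewrite a; left.
      + by rewrite a'; left; rewrite orbT.
      + by rewrite b b'; right.
    have c2 : edge_cover E (A :&: A') (e.2 |: (B :|: B')).
      move=> g /in3 [->|[->|[[a|b] [a'|b']]]]; rewrite !inE ?eqxx; auto.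
      + by rewrite ef eqxx; right.
      + by rewrite a a'; left.
      + by rewrite b'; right; rewrite !orbT.
      + by rewrite b; right; rewrite orbT.
      + by rewrite b; right; rewrite orbT.
    move: lA lA' (cov _ _ c1) (cov _ _ c2); rewrite cardsU1 ![#|A| + _]addnC ![#|A'| + _]addnC.
    rewrite [#|A :|: _| + _]addnC [#|A :&: _| + _]addnC.
    exact: (arith _ _ _ _ _ _ _ _ _ s2 s1).
have := cov [set e.1 | e in E] set0; rewrite cards0 addn0 => H.
apply: leq_trans (H _) (leq_imset_card _ _) => e eE; left; exact: imset_f.
Qed.

End Konig.

Section Paths.
Variable G : sgraph.
Local Notation adj := (@adj G).
Implicit Types (x y z : G) (s : seq G) (f : nat -> G).

(** The list contains both ends and is nonempty, so [size] counts vertices, a single vertex is a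
    walk, and joining two walks by an edge is plain concatenation. *)
Definition walk x y s :=
  if s is a :: s' then [&& a == x, path adj a s' & last a s' == y] else false.

Lemma walk1 x : walk x x [:: x].
Proof. by rewrite /= !eqxx. Qed.

Lemma walk_size x y s : walk x y s -> 0 < size s.
Proof. by case: s. Qed.

Lemma walk_head x y s : walk x y s -> x \in s.
Proof. by case: s => //= a s /andP[/eqP<- _]; rewrite inE eqxx. Qed.

Lemma walk_last x y s : walk x y s -> y \in s.
Proof. by case: s => //= a s /and3P[_ _ /eqP<-]; apply: mem_last. Qed.

Lemma walk_cat x y x' y' s s' :
  walk x y s -> walk x' y' s' -> adj y x' -> walk x y' (s ++ s').
Proof.
case: s => //= a s /and3P[-> p1 /eqP l1]; case: s' => //= b s' /and3P[/eqP-> p2 /eqP l2] yx.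
by rewrite cat_path p1 /= l1 yx p2 last_cat /= l2 eqxx.
Qed.

Lemma walk_rev x y s : walk x y s -> walk y x (rev s).
Proof.
case: s => //= a s /and3P[/eqP-> p1 /eqP l1].
have : path adj (last x s) (rev (belast x s)).
  by rewrite rev_path; apply: sub_path p1 => u v; rewrite adj_sym.
rewrite lastI rev_rcons l1 /= eqxx => -> /=.
case: s {p1} l1 => [|b s] /= l1; first by rewrite l1.
by rewrite rev_cons last_rcons.
Qed.

Lemma walk_cycle x y s : walk x y s -> adj y x -> cycle adj s.
Proof.
case: s => //= a s /and3P[/eqP-> p1 /eqP l1] yx.
by rewrite rcons_path p1 l1.
Qed.

Lemma walk_path x y s : path adj x s -> last x s = y -> walk x y (x :: s).
Proof. by move=> p l; rewrite /= eqxx p l eqxx. Qed.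

Lemma walk_prefix x y s z : walk x y s -> z \in s ->
  exists2 s1, walk x z s1 & {subset s1 <= s} /\ (uniq s -> uniq s1).
Proof.
case: s => // a s /= /and3P[/eqP-> p1 /eqP l1] zs.
case/splitPl: zs p1 l1 => p2 p3 lz; rewrite cat_path => /andP[p1 p1'] l1.
exists (x :: p2); first by rewrite walk_path.
split; first by move=> v; rewrite !inE mem_cat => /orP[->//|->]; rewrite orbT.
by move=> /= /andP[]; rewrite mem_cat negb_or cat_uniq => /andP[-> _] /and3P[->].
Qed.

Lemma connect_walk (A : pred G) x y :
  A x -> connect [rel u v | adj u v && A u && A v] x y ->
  exists2 s, walk x y s & uniq s /\ all A s.
Proof.
move=> Ax /connectP[p pp ->].
case/shortenP: pp => p' pp up _.
exists (x :: p'); last first.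
  split=> //; rewrite /= Ax /=.
  elim: p' x Ax pp {up} => //= a p' IH x Ax /andP[/andP[_ Aa] pp].
  by rewrite Aa /=; apply: IH pp.
by apply: walk_path => //; apply: sub_path pp => u v /= /andP[/andP[]].
Qed.

Lemma walk_connect (A : pred G) x y s : walk x y s -> all A s ->
  connect [rel u v | adj u v && A u && A v] x y.
Proof.
case: s => // a s /= /and3P[/eqP-> p1 /eqP<-] /andP[Ax As].
apply/connectP; exists s => //.
elim: s x Ax As p1 => //= b s IH x Ax /andP[Ab As] /andP[-> p1].
by rewrite Ax Ab /= IH.
Qed.

Definition seg f a n := [seq f i | i <- iota a n].

Lemma size_seg f a n : size (seg f a n) = n.
Proof. by rewrite size_map size_iota. Qed.

Lemma segP f a n v :
  reflect (exists2 i, a <= i < a + n & v = f i) (v \in seg f a n).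
Proof.
apply: (iffP mapP) => [[i]|[i]]; rewrite -?mem_iota => ? ?; exists i => //.
by rewrite -mem_iota.
Qed.

(* An infinite periodic traversal of a cycle of length c. *)
Definition traversal f c :=
  [/\ 1 < c, forall i, adj (f i) (f i.+1), forall i, f (i + c) = f i
    & forall i j, i < c -> j < c -> f i = f j -> i = j].

Lemma traversal_seq s : 1 < size s -> uniq s -> cycle adj s ->
  exists2 f, traversal f (size s) & forall v, (v \in s) = (v \in seg f 0 (size s)).
Proof.
case: s => // x0 s'; set s := x0 :: s' => s1 us cs.
pose f i := nth x0 s (i %% size s).
have fE i : i < size s -> f i = nth x0 s i by move=> lt; rewrite /f modn_small.
exists f.
  split=> //.
  - move=> i; rewrite /f.
    have lt : i %% size s < size s by rewrite ltn_mod; lia.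
    have /(pathP x0) H : path adj x0 (rcons s' x0) by [].
    have := H (i %% size s); rewrite size_rcons => /(_ lt).
    rewrite nth_rcons -[x0 :: _]/(rcons s x0) nth_rcons lt.
    have -> : i.+1 %% size s = (i %% size s).+1 %% size s by rewrite -addn1 -modnDml addn1.
    case: ltnP => h.
      by rewrite (@modn_small (i %% size s).+1).
    have -> : (i %% size s).+1 = size s by move: lt h => /=; lia.
    have -> : i %% size s == size s' by move: lt h => /=; lia.
    by rewrite modnn.
  - by move=> i; rewrite /f modnDr.
  - move=> i j li lj; rewrite !fE // => /eqP; rewrite nth_uniq // => /eqP //.
move=> v; apply/idP/segP => [vs|[i /= li ->]].
  exists (index v s); first by rewrite add0n leq0n index_mem.
  by rewrite fE ?index_mem // nth_index.
by rewrite fE // mem_nth.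
Qed.

Section Traversal.
Variables (f : nat -> G) (c : nat).
Hypothesis ft : traversal f c.

Lemma trav_gt1 : 1 < c. Proof. by case: ft. Qed.

Lemma trav_mod i : f (i %% c) = f i.
Proof.
case: ft => _ _ fp _; rewrite {2}(divn_eq i c).
elim: (i %/ c) => [|q IH] //; by rewrite mulSn -addnA addnC fp.
Qed.

Lemma trav_inj i j : f i = f j -> i = j %[mod c].
Proof.
rewrite -(trav_mod i) -(trav_mod j); case: ft => c1 _ _ fi /fi-> //; apply: ltn_pmod; lia.
Qed.

Lemma trav_shift a : traversal (fun i => f (a + i)) c.
Proof.
case: (ft) => c1 fa fp fi; split=> //.
- by move=> i; rewrite addnS.
- by move=> i; rewrite addnA.
- move=> i j li lj /trav_inj /eqP; rewrite eqn_modDl !modn_small // => /eqP //.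
Qed.

Lemma walk_seg a n : walk (f a) (f (a + n)) (seg f a n.+1).
Proof.
case: ft => _ fa _ _; apply: walk_path.
  by elim: n a => //= n IH a; rewrite fa IH.
by elim: n a => [|n IH] a /=; rewrite ?addn0 // IH addSnnS.
Qed.

Lemma uniq_seg a n : n <= c -> uniq (seg f a n).
Proof.
move=> len; rewrite map_inj_in_uniq ?iota_uniq // => i j.
rewrite !mem_iota => /andP[i1 i2] /andP[j1 j2] /trav_inj.
have -> : i = a + (i - a) by lia.
have -> : j = a + (j - a) by lia.
by move/eqP; rewrite eqn_modDl !modn_small; [move/eqP->|lia|lia].
Qed.

Lemma mem_seg_full a i : f i \in seg f a c.
Proof.
have c1 := trav_gt1.
apply/segP; exists (a + (i + (c - a %% c)) %% c); first by have := ltn_pmod (i + (c - a %% c)) (ltnW c1); lia.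
rewrite -trav_mod -[RHS]trav_mod; congr f.
rewrite modnDmr -(modnDml a).
have -> : a %% c + (i + (c - a %% c)) = i + c by have := ltn_pmod a (ltnW c1); lia.
by rewrite modnDr.
Qed.

End Traversal.
End Paths.

(** * Rerouting a longest cycle *)

Section LongestCycle.
Variables (G : sgraph) (A : pred G) (f : nat -> G) (c : nat).
Local Notation adj := (@adj G).
Implicit Types (x y z : G) (s : seq G) (l : seq nat).
Hypothesis ft : traversal f c.
Hypothesis fA : forall i, A (f i).
Hypothesis fmax : forall s, 1 < size s -> uniq s -> cycle adj s -> all A s -> size s <= c.

Definition off (s : seq G) := forall i, f i \notin s.

Lemma off_disjoint s l : off s -> ~~ has (mem s) [seq f i | i <- l].
Proof. by move=> o; apply/hasPn => v /mapP[i _ ->]; apply: o. Qed.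

Lemma uniq_trav_map l : uniq l -> all (fun i => i < c) l -> uniq [seq f i | i <- l].
Proof.
move=> ul /allP lc; rewrite map_inj_in_uniq // => i j /lc li /lc lj.
by case: ft => _ _ _; apply.
Qed.

Lemma closed_walk_size i j l x y s : uniq l -> all (fun i => i < c) l ->
  walk (f i) (f j) [seq f i | i <- l] -> walk x y s -> uniq s -> off s -> all A s ->
  adj (f j) x -> adj y (f i) -> size l + size s <= c.
Proof.
move=> ul lc wl ws us os As jx yi.
rewrite -(size_map f l) -size_cat; apply: fmax.
- by have := walk_size wl; have := walk_size ws; rewrite size_cat !size_map; lia.
- by rewrite cat_uniq uniq_trav_map // us has_sym off_disjoint.
- exact: walk_cycle (walk_cat wl ws jx) yi.
- by rewrite all_cat As andbT; apply/allP => v /mapP[? _ ->].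
Qed.

Lemma closed_walk_size2 i j l x y s i' j' (l' : seq nat) (x' y' : G) (s' : seq G) :
  uniq (l ++ l') -> all (fun i => i < c) (l ++ l') ->
  walk (f i) (f j) [seq f i | i <- l] -> walk x y s ->
  walk (f i') (f j') [seq f i | i <- l'] -> walk x' y' s' ->
  uniq (s ++ s') -> off (s ++ s') -> all A (s ++ s') ->
  adj (f j) x -> adj y (f i') -> adj (f j') x' -> adj y' (f i) ->
  size (l ++ l') + size (s ++ s') <= c.
Proof.
move=> ul lc wl ws wl' ws' us os As jx yi jx' yi'.
set t := [seq f i | i <- l] ++ s ++ [seq f i | i <- l'] ++ s'.
have pt : perm_eq ([seq f i | i <- l ++ l'] ++ (s ++ s')) t.
  by rewrite map_cat -catA perm_cat2l perm_catCA.
have -> : size (l ++ l') + size (s ++ s') = size t.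
  by rewrite /t !size_cat !size_map; clear; lia.
apply: fmax.
- rewrite /t !size_cat !size_map.
  by have := walk_size ws'; have := walk_size ws; clear; lia.
- by rewrite -(perm_uniq pt) cat_uniq uniq_trav_map // us has_sym off_disjoint.
- exact: walk_cycle (walk_cat wl (walk_cat ws (walk_cat wl' ws' jx') yi) jx) yi'.
- by rewrite -(perm_all _ pt) all_cat As andbT; apply/allP => v /mapP[? _ ->].
Qed.

(** Replacing the d - 1 inner vertices of an arc by [s] gives a cycle inside [A]. Here [A] is
    everything when the cycle is C, and the complement of C when it is D. *)
Lemma ear a d x y s : 0 < d < c -> walk x y s -> uniq s -> off s -> all A s ->
  adj (f a) x -> adj y (f (a + d)) -> size s < d.
Proof.
move=> dc ws us os As ax yad; have c1 := trav_gt1 ft.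
have wl := walk_seg ft (a + d) (c - d).
have ca : a + d + (c - d) = a + c by lia.
have fac : f (a + c) = f a by case: ft.
rewrite ca fac in wl.
have : size (seg f (a + d) (c - d).+1 ++ s) <= c.
  apply: fmax.
  - by rewrite size_cat size_seg; lia.
  - by rewrite cat_uniq us (uniq_seg ft) ?andbT /= 1?has_sym ?off_disjoint //; lia.
  - exact: walk_cycle (walk_cat wl ws ax) yad.
  - by rewrite all_cat As andbT; apply/allP => v /mapP[? _ ->].
by rewrite size_cat size_seg; lia.
Qed.

Lemma off_rev s : off s -> off (rev s).
Proof. by move=> o i; rewrite mem_rev. Qed.

Lemma ear_sym a d x y s : 0 < d < c -> walk x y s -> uniq s -> off s -> all A s ->
  adj (f a) x -> adj y (f (a + d)) -> size s < d /\ size s < c - d.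
Proof.
move=> dc ws us os As ax yad; split; first exact: ear dc ws us os As ax yad.
have E : a + d + (c - d) = a + c by lia.
have fE : f (a + c) = f a by case: ft.
have := @ear (a + d) (c - d) y x (rev s).
rewrite size_rev E fE rev_uniq all_rev (adj_sym x) (adj_sym _ y).
have dc' : 0 < c - d < c by lia.
by move=> /(_ dc' (walk_rev ws) us (off_rev os) As yad ax).
Qed.

Lemma walk_map_iota a n : walk (f a) (f (a + n)) [seq f i | i <- iota a n.+1].
Proof. exact: (walk_seg ft). Qed.

Lemma walk_map_rev_iota a n : walk (f (a + n)) (f a) [seq f i | i <- rev (iota a n.+1)].
Proof. rewrite map_rev; exact: walk_rev (walk_map_iota a n). Qed.

Lemma iota_disj a n b m : a + n <= b -> ~~ has (mem (iota a n)) (iota b m).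
Proof. by move=> ab; apply/hasPn => i; rewrite !inE !mem_iota; lia. Qed.

Lemma all_iota_lt a n b : a + n <= b -> all (fun i => i < b) (iota a n).
Proof. by move=> ab; apply/allP => i; rewrite mem_iota; lia. Qed.

(* In the four lemmas below the traversal starts right after an attachment
   vertex f c.-1, and f 0 is its successor. *)
Lemma cross_inner u v x y s : u < v < c ->
  adj (f 0) (f v) -> adj y (f u) ->
  walk x y s -> uniq s -> off s -> all A s -> adj (f c.-1) x ->
  size s < v - u.
Proof.
move=> uvc a0v yu ws us os As cx.
(* Back from [f u] to [f 0], over the chord to [f v], on to [f c.-1] and home through [s]: only the
   v - u - 1 positions strictly between [u] and [v] are lost. *)
pose l := rev (iota 0 u.+1) ++ iota v (c - v.+1).+1.
have c1 : v + (c - v.+1) = c.-1 by lia.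
have wl : walk (f u) (f c.-1) [seq f i | i <- l].
  rewrite map_cat -c1; apply: walk_cat (walk_map_iota _ _) a0v.
  exact: (walk_map_rev_iota 0 u).
have := closed_walk_size _ _ wl ws us os As cx yu.
rewrite /l size_cat size_rev !size_iota cat_uniq rev_uniq !iota_uniq all_cat all_rev !all_iota_lt; try lia.
rewrite andbT; have -> : has (mem (rev (iota 0 u.+1))) (iota v (c - v.+1).+1) = false.
  apply/negbTE/hasPn => i; rewrite !inE mem_rev !mem_iota; lia.
move=> /(_ isT isT); lia.
Qed.

Lemma cross_outer u v (l : nat) x y s : u < v -> v <= l -> l < c.-1 ->
  adj (f 0) (f v) -> adj (f u) (f l.+1) ->
  walk x y s -> uniq s -> off s -> all A s -> adj (f c.-1) x -> adj y (f l) ->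
  size s < v - u.
Proof.
move=> uv vl lc a0v aul ws us os As cx yl.
(* Here [l] is a second attachment and [l.+1] its successor. Back from [f l] to [f v], chord to
   [f 0], on to [f u], chord to [f l.+1], on to [f c.-1], home through [s]: again only the positions
   strictly between [u] and [v] are lost. *)
pose t := rev (iota v (l - v).+1) ++ iota 0 u.+1 ++ iota l.+1 (c - l.+2).+1.
have c1 : l.+1 + (c - l.+2) = c.-1 by lia.
have c2 : v + (l - v) = l by lia.
have wl : walk (f l) (f c.-1) [seq f i | i <- t].
  have w1 := walk_map_rev_iota v (l - v); rewrite c2 in w1.
  have w2 := walk_map_iota 0 u; rewrite add0n in w2.
  have w3 := walk_map_iota l.+1 (c - l.+2); rewrite c1 in w3.
  rewrite !map_cat; apply: walk_cat (walk_cat w2 w3 aul) _ => //; first exact: w1.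
  by rewrite adj_sym.
have := closed_walk_size _ _ wl ws us os As cx yl.
rewrite /t !size_cat size_rev !size_iota !cat_uniq rev_uniq !iota_uniq !all_cat all_rev !all_iota_lt; try lia.
rewrite iota_disj; last lia.
have -> : has (mem (rev (iota v (l - v).+1))) (iota 0 u.+1 ++ iota l.+1 (c - l.+2).+1) = false.
  apply/negbTE/hasPn => i; rewrite !inE mem_rev mem_cat !mem_iota; lia.
move=> /(_ isT isT); lia.
Qed.

Lemma cross_edge (l : nat) x y s : l < c.-1 -> adj (f 0) (f l.+1) ->
  walk x y s -> uniq s -> off s -> all A s -> adj (f c.-1) x -> ~~ adj y (f l).
Proof.
move=> lc a0l ws us os As cx; apply/negP => yl.
(* This closed walk loses no vertex of the cycle, so the nonempty [s] would make it longer. In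
   [cross_vertex] the same walk passes from [f 0] to [f l.+1] through [z]. *)
pose t := rev (iota 0 l.+1) ++ iota l.+1 (c - l.+2).+1.
have c1 : l.+1 + (c - l.+2) = c.-1 by lia.
have wl : walk (f l) (f c.-1) [seq f i | i <- t].
  have w1 := walk_map_rev_iota 0 l; rewrite add0n in w1.
  have w3 := walk_map_iota l.+1 (c - l.+2); rewrite c1 in w3.
  by rewrite map_cat; apply: walk_cat w1 w3 a0l.
have := closed_walk_size _ _ wl ws us os As cx yl; have := walk_size ws.
rewrite /t !size_cat size_rev !size_iota !cat_uniq rev_uniq !iota_uniq !all_cat all_rev !all_iota_lt; try lia.
have -> : has (mem (rev (iota 0 l.+1))) (iota l.+1 (c - l.+2).+1) = false.
  apply/negbTE/hasPn => i; rewrite !inE mem_rev !mem_iota; lia.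
move=> ss /(_ isT isT); lia.
Qed.

Lemma cross_vertex (l : nat) x y s z : l < c.-1 -> adj (f 0) z -> adj z (f l.+1) ->
  A z -> off [:: z] -> z \notin s ->
  walk x y s -> uniq s -> off s -> all A s -> adj (f c.-1) x -> ~~ adj y (f l).
Proof.
move=> lc a0z azl Az oz zs ws us os As cx; apply/negP => yl.
have c1 : l.+1 + (c - l.+2) = c.-1 by lia.
have w1 := walk_map_rev_iota 0 l; rewrite add0n in w1.
have w3 := walk_map_iota l.+1 (c - l.+2); rewrite c1 in w3.
have u1 : uniq (rev (iota 0 l.+1) ++ iota l.+1 (c - l.+2).+1).
  rewrite cat_uniq rev_uniq !iota_uniq andbT.
  apply/hasPn => i; rewrite !inE mem_rev !mem_iota; clear; lia.
have u2 : all (fun i => i < c) (rev (iota 0 l.+1) ++ iota l.+1 (c - l.+2).+1).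
  by rewrite all_cat all_rev !all_iota_lt //; move: lc; clear; lia.
have u3 : uniq ([:: z] ++ s) by rewrite /= zs.
have u4 : off ([:: z] ++ s) by move=> i; rewrite mem_cat negb_or oz os.
have u5 : all A ([:: z] ++ s) by rewrite /= Az.
have := closed_walk_size2 u1 u2 w1 (walk1 z) w3 ws u3 u4 u5 a0z azl cx yl.
by rewrite size_cat size_rev !size_iota /=; move: lc; clear; lia.
Qed.

End LongestCycle.

(** * Degree sums over the successors of attachment vertices *)

Lemma sum_card_rel (S T : finType) (R : S -> T -> bool) (D : {set S}) :
  \sum_(x in D) #|[set y | R x y]| = #|[set e : S * T | (e.1 \in D) && R e.1 e.2]|.
Proof.
rewrite -sum1_card.
under eq_bigr => x _ do rewrite -sum1_card.
rewrite pair_big_dep /=; apply: eq_bigl => -[x y]; by rewrite !inE.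
Qed.

Section Attachments.
Variables (G : sgraph) (f : nat -> G) (c : nat).
Local Notation adj := (@adj G).
Hypothesis ft : traversal f c.
Hypothesis fmax : forall s : seq G, 1 < size s -> uniq s -> cycle adj s -> size s <= c.

(* H is a component of the graph off the cycle, P the positions of k vertices of
   the cycle attached to H, any two of them being joined through H by a long path. *)
Variables (H : {set G}) (h : G) (P : {set 'I_c}) (k : nat).
Hypothesis cardP : #|P| = k.
Hypothesis hH : h \in H.
Hypothesis Hoff : forall i, f i \notin H.
Hypothesis Hconn : forall u v, u \in H -> v \in H ->
  exists2 s, walk u v s & uniq s /\ {subset s <= H}.
Hypothesis Hclosed : forall u v, u \in H -> adj u v -> (forall i, f i != v) -> v \in H.
Hypothesis PH : forall p, p \in P -> exists x s,
  [/\ walk x h s, uniq s, {subset s <= H}, adj (f p) x & k <= size s].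
Hypothesis PP : forall p q, p \in P -> q \in P -> p != q -> exists x y s,
  [/\ walk x y s, uniq s, {subset s <= H}, adj (f p) x /\ adj y (f q) & k <= size s].

Let c1 : 1 < c. Proof. exact: trav_gt1 ft. Qed.

Let fmaxT : forall s : seq G, 1 < size s -> uniq s -> cycle adj s -> all predT s -> size s <= c.
Proof. by move=> s ? ? ? _; apply: fmax. Qed.

Let offH (s : seq G) : {subset s <= H} -> forall a, off (fun i => f (a + i)) s.
Proof. by move=> sH a i; apply/negP => /sH; apply/negP; apply: Hoff. Qed.

Lemma succ_not_adj (p : 'I_c) v : p \in P -> v \in H -> ~~ adj (f p.+1) v.
Proof.
move=> pP vH; apply/negP => pv.
have [x [s [ws us sH px _]]] := PH pP.
have [t wt [ut tH]] := Hconn (sH _ (walk_head ws)) vH.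
have := @ear G predT f c ft (fun=> isT) fmaxT p 1 x v t.
rewrite adj_sym in pv.
rewrite c1 addn1 => /(_ isT wt ut (offH tH 0) (all_predT _) px pv).
by have := walk_size wt; case: (size t).
Qed.

(* Number of steps from position p forward to u, counted as c when p = u. *)
Definition steps (p u : nat) := if p < u then u - p else u + c - p.

Lemma f_steps (p u : 'I_c) : f (p + steps p u) = f u.
Proof.
rewrite /steps; case: ifP => pu; first by congr f; lia.
case: ft => _ _ fp _; rewrite -[RHS]fp; congr f; have := ltn_ord p; lia.
Qed.

Lemma f_pred_steps (p u : 'I_c) : f (p.+1 + (steps p u).-1) = f u.
Proof.
rewrite -(f_steps p u); congr f; rewrite /steps.
by case: ifP; have := ltn_ord p; lia.
Qed.

Lemma steps_bound (p u : 'I_c) : 0 < steps p u <= c.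
Proof. by rewrite /steps; case: ifP; have := ltn_ord p; have := ltn_ord u; lia. Qed.

Lemma f_last (p : 'I_c) : f (p.+1 + c.-1) = f p.
Proof. by case: ft => _ _ fp _; rewrite -[RHS]fp; congr f; lia. Qed.

(** In the traversal starting right after [p], the vertex at [u] has index [(steps p u).-1]; since
    [steps p p] is [c], [p] itself comes last, as in [cross_inner]. *)
Lemma succ_inner (p u v : 'I_c) : p \in P -> steps p u < steps p v ->
  adj (f p.+1) (f v) -> adj h (f u) -> k < steps p v - steps p u.
Proof.
move=> pP uv pv hu; have [x [s [ws us sH px ks]]] := PH pP.
have := @cross_inner G predT _ c (trav_shift ft p.+1) (fun=> isT) fmaxT
  (steps p u).-1 (steps p v).-1 x h s.
rewrite addn0 !f_pred_steps f_last.
have := steps_bound p u; have := steps_bound p v => b1 b2.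
have lt : (steps p u).-1 < (steps p v).-1 < c by move: b1 b2 uv; clear; lia.
move=> /(_ lt pv hu ws us (offH sH _) (all_predT _) px).
by move: b2 uv ks; clear; lia.
Qed.

Lemma steps_lt (p q : 'I_c) : p != q -> steps p q < c.
Proof.
move=> pq; have ne : (p : nat) <> q by move/val_inj => E; rewrite E eqxx in pq.
by move: ne (ltn_ord q) (ltn_ord p); rewrite /steps; clear; case: ifP; lia.
Qed.

Lemma f_succ_steps (p q : 'I_c) : f (p.+1 + (steps p q).-1.+1) = f q.+1.
Proof.
have [j jE] : exists j, p.+1 + (steps p q).-1 = q + j * c.
  by rewrite /steps; case: ifP => pq; [exists 0|exists 1]; have := ltn_ord p; lia.
by rewrite addnS jE -addSn -(trav_mod ft) addnC modnMDl (trav_mod ft).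
Qed.

Lemma succ_outer (p q u v : 'I_c) : p \in P -> q \in P -> p != q ->
  steps p u < steps p v -> steps p v <= steps p q ->
  adj (f p.+1) (f v) -> adj (f q.+1) (f u) -> k < steps p v - steps p u.
Proof.
move=> pP qP pq uv vq pv qu; have [x [y [s [ws us sH [px yq] ks]]]] := PP pP qP pq.
have sq := steps_lt pq.
have := steps_bound p u; have := steps_bound p v; have := steps_bound p q => b3 b1 b2.
have := @cross_outer G predT _ c (trav_shift ft p.+1) (fun=> isT) fmaxT
  (steps p u).-1 (steps p v).-1 (steps p q).-1 x y s.
rewrite f_succ_steps addn0 !f_pred_steps f_last.
rewrite adj_sym in qu.
have [l1 l2 l3] : [/\ (steps p u).-1 < (steps p v).-1, (steps p v).-1 <= (steps p q).-1
    & (steps p q).-1 < c.-1] by move: b1 b2 b3 sq uv vq; clear; split; lia.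
move=> /(_ l1 l2 l3 pv qu ws us (offH sH _) (all_predT _) px yq).
by move: b2 uv ks; clear; lia.
Qed.


Lemma succ_indep (p q : 'I_c) : p \in P -> q \in P -> p != q ->
  ~~ adj (f p.+1) (f q.+1).
Proof.
move=> pP qP pq; apply/negP => apq.
have [x [y [s [ws us sH [px yq] ks]]]] := PP pP qP pq.
have := @cross_edge G predT _ c (trav_shift ft p.+1) (fun=> isT) fmaxT (steps p q).-1 x y s.
rewrite f_succ_steps addn0 !f_pred_steps f_last yq.
have := steps_lt pq; have := steps_bound p q => b1 b2.
have lt : (steps p q).-1 < c.-1 by move: b1 b2; clear; lia.
by move=> /(_ lt apq ws us (offH sH _) (all_predT _) px).
Qed.

Lemma succ_no_common (p q : 'I_c) z : p \in P -> q \in P -> p != q ->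
  (forall i, f i != z) -> adj (f p.+1) z -> ~~ adj (f q.+1) z.
Proof.
move=> pP qP pq zC pz; apply/negP => qz.
have [x [y [s [ws us sH [px yq] ks]]]] := PP pP qP pq.
have zs : z \notin s by apply/negP => /sH zH; have := succ_not_adj pP zH; rewrite pz.
have := @cross_vertex G predT _ c (trav_shift ft p.+1) (fun=> isT) fmaxT (steps p q).-1 x y s z.
rewrite f_succ_steps addn0 !f_pred_steps f_last yq.
have := steps_lt pq; have := steps_bound p q => b1 b2.
have lt : (steps p q).-1 < c.-1 by move: b1 b2; clear; lia.
rewrite adj_sym in qz.
have oz : off (fun i => f (p.+1 + i)) [:: z] by move=> i; rewrite inE zC.
by move=> /(_ lt pz qz isT oz zs ws us (offH sH _) (all_predT _) px).
Qed.


Hypothesis lastP : exists2 p : 'I_c, p \in P & p.+1 = c.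

Definition source (o : option 'I_c) : G := if o is Some p then f p.+1 else h.

Definition sources : {set option 'I_c} := None |: [set Some p | p in P].

Lemma some_sources p : (Some p \in sources) = (p \in P).
Proof.
rewrite !inE /=; apply/imsetP/idP => [[q qP [->]]//|pP]; by exists p.
Qed.

Lemma card_sources : #|sources| = k.+1.
Proof.
rewrite cardsU1 card_imset; last by move=> x y [].
by rewrite cardP (_ : None \notin _ = true) ?add1n //; apply/negP => /imsetP[].
Qed.

(* Position of a source when walking backwards from u, the vertex h coming last. *)
Definition rank (u : 'I_c) (o : option 'I_c) :=
  if o is Some p then #|[set q in P | steps q u <= steps p u]| else k.+1.

Lemma rank_some_le u p : rank u (Some p) <= k.
Proof. by rewrite -cardP; apply: subset_leq_card; apply/subsetP => q; rewrite inE => /andP[]. Qed.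

Lemma rank_bound u o : o \in sources -> 0 < rank u o <= k.+1.
Proof.
case: o => [p|] /=; last by rewrite leqnn.
rewrite some_sources => pP; rewrite (leqW (rank_some_le u p)) andbT.
by apply/card_gt0P; exists p; rewrite inE pP leqnn.
Qed.

Lemma rank_lt u p q : rank u (Some p) < rank u (Some q) -> steps p u < steps q u.
Proof.
rewrite !ltnNge; apply: contra => qp; apply: subset_leq_card.
by apply/subsetP => x; rewrite !inE => /andP[-> /leq_trans->].
Qed.

Lemma steps_inj (u p q : 'I_c) : steps p u = steps q u -> p = q.
Proof.
move=> E; apply: val_inj => /=; move: E (ltn_ord p) (ltn_ord q) (ltn_ord u).
by rewrite /steps; clear; do 2!case: ifP; lia.
Qed.

Lemma rank_inj u o o' : o \in sources -> o' \in sources -> rank u o = rank u o' -> o = o'.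
Proof.
case: o o' => [p|] [q|] //.
- rewrite !some_sources => pP qP E; congr Some; apply: (@steps_inj u).
  have mono a b : a \in P -> b \in P -> steps a u < steps b u -> rank u (Some a) < rank u (Some b).
    move=> aP bP ab; apply: proper_card; apply/properP; split.
      by apply/subsetP => x; rewrite !inE => /andP[-> /leq_trans->] //; apply: ltnW.
    by exists b; rewrite !inE bP ?leqnn // -ltnNge.
  by case: (ltngtP (steps p u) (steps q u)) => // /mono H'; have := H'; rewrite E; [move/(_ pP qP)|move/(_ qP pP)]; rewrite ltnn.
- by move=> _ _ /= E; have := rank_some_le u p; rewrite /= E ltnn.
- by move=> _ _ /= E; have := rank_some_le u q; rewrite /= -E ltnn.
Qed.

(** [P] cuts the cycle into k arcs, each starting at a successor and ending in an attachment; this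
    is the index of the arc containing [u]. *)
Definition before (u : 'I_c) := #|[set q in P | q < u]|.

Lemma before_lt u : before u < k.
Proof.
have [p pP pc] := lastP; rewrite -cardP; apply: proper_card; apply/properP; split.
  by apply/subsetP => q; rewrite inE => /andP[].
by exists p => //; rewrite inE pP /=; have := ltn_ord u; lia.
Qed.

Definition cycle_edges :=
  [set e : option 'I_c * 'I_c | (e.1 \in sources) && adj (source e.1) (f e.2)].

Lemma in_cycle_edges e :
  (e \in cycle_edges) = (e.1 \in sources) && adj (source e.1) (f e.2).
Proof. by rewrite inE. Qed.

Lemma cycle_edges_not_succ e q : e \in cycle_edges -> q \in P -> f e.2 != f q.+1.
Proof.
case: e => o u; rewrite in_cycle_edges /= => /andP[oS ou] qP; apply/eqP => E; move: ou; rewrite E.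
case: o oS => [p|] /=; last by rewrite adj_sym (negbTE (succ_not_adj qP hH)).
rewrite some_sources => pP; case: (eqVneq p q) => [->|ne]; first by rewrite adj_irr.
by rewrite (negbTE (succ_indep pP qP ne)).
Qed.

Lemma cycle_edges_gt0 e : e \in cycle_edges -> 0 < e.2.
Proof.
move=> eE; rewrite lt0n; apply/eqP => E0; have [p pP pc] := lastP.
have := cycle_edges_not_succ eE pP; rewrite E0 pc; case: ft => _ _ fp _.
by rewrite -(fp 0) eqxx.
Qed.

(** Inside one arc the weight is position plus rank up to a constant, and the crossing lemmas make
    it injective there. The first position of an arc is a successor and sees no source, so an arc of
    a positions has a - 1 useful ones, which ranks from 1 to k + 1 spread over a + k - 1 values.
    Each of the k arcs thus needs k - 1 extra values. The [- 2] normalizes a positive position and a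
    positive rank. *)
Definition weight (e : option 'I_c * 'I_c) := e.2 + before e.2 * k.-1 + rank e.2 e.1 - 2.

Lemma weight_bound e : e \in cycle_edges -> weight e < c + k * k.-1.
Proof.
move=> eE; have u0 := cycle_edges_gt0 eE; move: eE u0; case: e => o u.
rewrite in_cycle_edges /= => /andP[oS _] u0; rewrite /weight /=.
have b1 := before_lt u; have r1 := rank_bound u oS; have uc := ltn_ord u.
have : before u * k.-1 <= k.-1 * k.-1 by rewrite leq_mul2r; apply/orP; right; lia.
have -> : k * k.-1 = k.-1 * k.-1 + k.-1 by rewrite -mulSnr prednK //; lia.
move: u0 b1 r1 uc; clear; lia.
Qed.

Lemma weight_lt_arc o o' (u u' : 'I_c) : (o, u) \in cycle_edges -> (o', u') \in cycle_edges ->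
  u < u' -> before u < before u' -> weight (o, u) < weight (o', u').
Proof.
move=> e e' uu' bb'; have u0 := cycle_edges_gt0 e; have u1 := cycle_edges_gt0 e'.
have [q qP /andP[uq qu']] : exists2 q : 'I_c, q \in P & u <= q < u'.
  apply: NNPP => N; move: bb'; rewrite ltnNge => /negP; apply; apply: subset_leq_card.
  apply/subsetP => q; rewrite !inE => /andP[qP qu']; rewrite qP /= ltnNge; apply/negP => uq.
  by apply: N; exists q => //; rewrite uq.
have nq : u' <> q.+1 :> nat.
  move=> E; have := cycle_edges_not_succ e' qP; by rewrite /= E eqxx.
rewrite /weight /=; move: e e'; rewrite !in_cycle_edges /= => /andP[oS _] /andP[oS' _].
have r1 := rank_bound u oS; have r1' := rank_bound u' oS'.
have : (before u).+1 * k.-1 <= before u' * k.-1 by rewrite leq_mul2r bb' orbT.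
rewrite mulSnr; move: (before_lt u) r1 r1' uq qu' nq u0 u1 => /=; clear; lia.
Qed.

(** On one arc the ranks at [u] and [u'] agree, so equal weights make the rank of [o] exceed that of
    [o'] by exactly [u' - u], which is therefore at most [k]. But then the edges cross in the order
    treated by [succ_outer] or [succ_inner], and these demand a difference above [k]. *)
Lemma weight_inj_lt o o' (u u' : 'I_c) : (o, u) \in cycle_edges -> (o', u') \in cycle_edges ->
  u < u' -> weight (o, u) = weight (o', u') -> False.
Proof.
move=> e e' uu' ww'; have u0 := cycle_edges_gt0 e; have u1 := cycle_edges_gt0 e'.
rewrite /= in u0 u1; case: (ltnP (before u) (before u')) => [/(weight_lt_arc e e' uu')|bb']; first by rewrite ww' ltnn.
have sub : [set q in P | q < u] \subset [set q in P | q < u'].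
  by apply/subsetP => q; rewrite !inE => /andP[-> /ltn_trans->].
have Eb : [set q in P | q < u] = [set q in P | q < u'].
  by apply/eqP; rewrite eqEcard sub.
have nob q : q \in P -> ~~ (u <= q < u').
  move=> qP; move/setP: Eb => /(_ q); rewrite !inE qP /=; lia.
have st q : q \in P -> steps q u' = steps q u + (u' - u).
  move=> /nob; rewrite /steps; have := ltn_ord q; have := ltn_ord u'; move: uu'; clear.
  by do 2!case: ifP; lia.
have rk q : q \in P -> rank u' (Some q) = rank u (Some q).
  move=> qP; rewrite /rank; apply: eq_card => x; rewrite !inE.
  by case: (boolP (x \in P)) => //= xP; rewrite !st // leq_add2r.
move: e e'; rewrite !in_cycle_edges /= => /andP[oS ou] /andP[oS' ou'].
have r1 := rank_bound u oS; have r1' := rank_bound u' oS'.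
have E : rank u o = rank u' o' + (u' - u).
  have Eb' : before u' = before u by rewrite /before Eb.
  by move: ww' u0 u1; rewrite /weight /= Eb'; lia.
have rN v : rank v None = k.+1 by [].
case: o' oS' ou' r1' E {ww'} => [p|]; last by rewrite rN => _ _ _ E; move: E r1 uu'; clear; lia.
rewrite some_sources => pP pu' r1' E.
have stp := st _ pP.
case: o oS ou r1 E => [q|].
  rewrite some_sources => qP qu r1 E.
  have lt : rank u' (Some p) < rank u' (Some q).
    by rewrite (rk q qP) E; move: uu'; clear; lia.
  have pq : p != q by apply/eqP => E'; rewrite E' ltnn in lt.
  have := rank_lt lt => slt.
  have le : steps p u' <= steps p q.
    move: slt (ltn_ord p) (ltn_ord q) (ltn_ord u'); rewrite /steps; clear.
    by do 3!case: ifP; lia.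
  have lt' : steps p u < steps p u' by rewrite stp; move: uu'; clear; lia.
  have := succ_outer pP qP pq lt' le pu' qu; rewrite stp.
  by have := rank_some_le u q; rewrite E; clear; lia.
move=> _ hu _ E.
have lt' : steps p u < steps p u' by rewrite stp; move: uu'; clear; lia.
have := succ_inner pP lt' pu' hu; rewrite stp; move: E r1'; rewrite rN; clear; lia.
Qed.

Lemma card_cycle_edges : #|cycle_edges| <= c + k * k.-1.
Proof.
apply: (card_le_inj weight_bound) => -[o u] [o' u'] e e' E.
case: (ltngtP u u') => [lt|gt|/val_inj Eu].
- by case: (weight_inj_lt e e' lt E).
- by case: (weight_inj_lt e' e gt (esym E)).
subst u'; congr pair; move: (e) (e') E (cycle_edges_gt0 e); rewrite !in_cycle_edges /= /weight /=.
move=> /andP[oS _] /andP[oS' _] E u0; apply: (rank_inj oS oS' (u := u)).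
by move: E u0 (rank_bound u oS) (rank_bound u oS'); clear; lia.
Qed.

Definition outer_edges := [set e : option 'I_c * G |
  (e.1 \in sources) && (adj (source e.1) e.2 && (e.2 \notin seg f 0 c))].

Lemma in_outer_edges e : (e \in outer_edges) =
  (e.1 \in sources) && (adj (source e.1) e.2 && (e.2 \notin seg f 0 c)).
Proof. by rewrite inE. Qed.

Lemma not_seg z : z \notin seg f 0 c -> forall i, f i != z.
Proof. by move=> zC i; apply: contraNneq zC => <-; apply: mem_seg_full. Qed.

(** Off the cycle no vertex sees two sources and [h] sees none, so these edges inject into the
    vertices off the cycle other than [h]. *)
Lemma card_outer_edges : #|outer_edges| + c < gorder G.
Proof.
have inj : {in outer_edges &, injective snd}.
  move=> -[o z] [o' z']; rewrite !in_outer_edges /= => /and3P[oS oz zC] /and3P[oS' oz' _] E; subst z'.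
  congr pair; have nz := not_seg zC.
  have hz a : a \in P -> adj h z -> adj (f a.+1) z -> False.
    by move=> aP hz az; have := succ_not_adj aP (Hclosed hH hz nz); rewrite az.
  case: o o' oS oS' oz oz' => [p|] [q|] //=; rewrite ?some_sources => pP qP pz qz.
  - congr Some; apply/eqP/negPn/negP => pq.
    by have := succ_no_common pP qP pq nz pz; rewrite qz.
  - by case: (hz p).
  - by case: (hz q).
have : #|snd @: outer_edges| <= #|~: (h |: [set z in seg f 0 c])|.
  apply: subset_leq_card; apply/subsetP => z /imsetP[[o z'] /= +->].
  rewrite in_outer_edges /= => /and3P[oS oz zC]; rewrite !inE negb_or zC andbT.
  apply/eqP => E; subst z'; move: oz; case: o oS => [p|] /=; last by rewrite adj_irr.
  by rewrite some_sources => pP; rewrite (negbTE (succ_not_adj pP hH)).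
have cC : #|[set z in seg f 0 c]| = c.
  have := uniq_seg ft 0 (leqnn c); move/card_uniqP; rewrite size_seg => cE.
  by rewrite -[RHS]cE; apply: eq_card => z; rewrite inE.
have cU : #|h |: [set z in seg f 0 c]| = c.+1.
  rewrite cardsU1 inE cC (_ : h \notin seg f 0 c) //.
  by apply/negP => /segP[i _ E]; have := Hoff i; rewrite -E hH.
rewrite card_in_imset // (cardsCs (~: _)) setCK cU -/(gorder G).
have := max_card (mem (h |: [set z in seg f 0 c])); rewrite cU -/(gorder G); clear; lia.
Qed.

Lemma degree_split v : degree v =
  #|[set u : 'I_c | adj v (f u)]| + #|[set z | adj v z && (z \notin seg f 0 c)]|.
Proof.
rewrite /degree -(cardsID [set z in seg f 0 c]); congr (_ + _); last first.
  by apply: eq_card => z; rewrite !inE andbC.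
rewrite -(@card_in_imset _ _ (fun u : 'I_c => f u)); last first.
  by move=> x y _ _ E; apply: val_inj; case: ft => _ _ _ fi; exact: fi (ltn_ord x) (ltn_ord y) E.
apply: eq_card => z; rewrite !inE; apply/andP/imsetP => [[vz /segP[i /= ic zi]]|[u]].
  by rewrite add0n in ic; exists (Ordinal ic); rewrite ?inE -?zi.
by rewrite inE => vu ->; rewrite vu; split=> //; apply: mem_seg_full.
Qed.

Lemma attachments_degree_bound d : (forall v : G, d <= degree v) ->
  k.+1 * d + 1 <= gorder G + k * k.-1.
Proof.
move=> dm; have : \sum_(o in sources) d <= \sum_(o in sources) degree (source o).
  by apply: leq_sum => o _; apply: dm.
rewrite sum_nat_const card_sources.
under [X in _ <= X]eq_bigr => o _ do rewrite degree_split.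
have E1 : \sum_(o in sources) #|[set u : 'I_c | adj (source o) (f u)]| = #|cycle_edges|.
  exact: (sum_card_rel (fun o (u : 'I_c) => adj (source o) (f u))).
have E2 : \sum_(o in sources) #|[set z | adj (source o) z && (z \notin seg f 0 c)]|
    = #|outer_edges|.
  exact: (sum_card_rel (fun o z => adj (source o) z && (z \notin seg f 0 c))).
rewrite big_split /= E1 E2 => le.
have [le2 cG] : #|outer_edges| <= gorder G - c.+1 /\ c < gorder G.
  by have := card_outer_edges; clear; lia.
by have := leq_trans le (leq_add card_cycle_edges le2); move: cG; clear; lia.
Qed.

End Attachments.

(** * Linked sets and their attachments *)

Lemma connect_stable (T : finType) (e : rel T) (X : pred T) x y :
  (forall u v, X u -> e u v -> X v) -> X x -> connect e x y -> X y.
Proof.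
move=> Xe Xx /connectP[p pp ->]; elim: p x Xx pp => //= a p IH x Xx /andP[xa pp].
by apply: IH pp; apply: Xe xa.
Qed.

Lemma subset_of_card (T : finType) (A : {set T}) k : k <= #|A| ->
  exists2 B : {set T}, B \subset A & #|B| = k.
Proof.
move=> kA; exists [set x in take k (enum A)].
  by apply/subsetP => x; rewrite inE => /mem_take; rewrite mem_enum.
have u : uniq (take k (enum A)) by apply: take_uniq; apply: enum_uniq.
move/card_uniqP: u => u; rewrite cardsE u size_take -cardE; case: ltnP => //; lia.
Qed.

Section WalkSplit.
Variable G : sgraph.
Implicit Types (x y z a b : G) (s t w : seq G).

Lemma walk_cat_inv x y z s t : walk x y (s ++ z :: t) ->
  walk x z (rcons s z) /\ walk z y (z :: t).
Proof.
case: s => [|b s] /=.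
  by move=> /and3P[/eqP-> -> ->]; rewrite !eqxx.
rewrite cat_path last_cat /= rcons_path last_rcons => /and3P[-> /and3P[-> -> ->] ->].
by rewrite !eqxx.
Qed.

Lemma walk_split2 x y a b s : walk x y s -> uniq s -> a \in s -> b \in s -> a != b ->
  exists s1 s2, [/\ walk x a s1 /\ walk b y s2 \/ walk x b s1 /\ walk a y s2,
    uniq (s1 ++ s2) & {subset s1 ++ s2 <= s}].
Proof.
move=> ws us /splitPr H; case: H ws us => p q ws us bs ab.
have := walk_cat_inv ws => -[w1 w2].
have : b \in p \/ b \in q.
  by move: bs; rewrite mem_cat inE eq_sym (negbTE ab) /= => /orP.
case=> [/splitPr H|/splitPr H].
- case: H w1 us => p1 p2; rewrite rcons_cat rcons_cons => /walk_cat_inv[w3 w4] us.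
  have sub : subseq (rcons p1 b ++ a :: q) ((p1 ++ b :: p2) ++ a :: q).
    by apply: cat_subseq => //; rewrite -cat_rcons prefix_subseq.
  exists (rcons p1 b), (a :: q); split; [by right|exact: subseq_uniq us|].
  by move=> v; apply: mem_subseq sub v.
- case: H w2 us => p1 p2; rewrite -cat_cons => /walk_cat_inv[w3 w4] us.
  have sub : subseq (rcons p a ++ b :: p2) (p ++ (a :: p1) ++ b :: p2).
    rewrite cat_cons -(cat_rcons a p); exact: cat_subseq (subseq_refl _) (suffix_subseq _ _).
  exists (rcons p a), (b :: p2); split; [by left|exact: subseq_uniq us|].
  by move=> v; apply: mem_subseq sub v.
Qed.

Lemma uniq_cat3 s t w : uniq s -> uniq t -> uniq w ->
  (forall v, v \in s -> v \notin t) -> (forall v, v \in s -> v \notin w) ->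
  (forall v, v \in t -> v \notin w) -> uniq (s ++ t ++ w).
Proof.
move=> us ut uw st sw tw; rewrite !cat_uniq us ut uw has_cat negb_or /= !andbT -andbA.
apply/and3P; split.
- by apply/hasPn => v vt; apply/negP => /st; rewrite vt.
- by apply/hasPn => v vw; apply/negP => /sw; rewrite vw.
- by apply/hasPn => v vw; apply/negP => /tw; rewrite vw.
Qed.

Lemma uniq_cat2 s t : uniq s -> uniq t ->
  (forall v, v \in s -> v \notin t) -> uniq (s ++ t).
Proof. by move=> us ut st; rewrite -[t]cats0; apply: uniq_cat3. Qed.

End WalkSplit.

Section LinkedSet.
Variables (G : sgraph) (C : {set G}) (k : nat).
Local Notation adj := (@adj G).
Implicit Types (x y z a b u v : G) (s t w : seq G) (U : {set G}).

Definition linked U := forall u v, u \in U -> v \in U -> u != v ->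
  exists2 s, walk u v s & [/\ uniq s, {subset s <= U} & k <= size s].

(** Two vertices of the ear leave it by its two ends and use a long walk of [U] from [u] to [v]. A
    vertex of the ear reaches [b] in [U] by leaving towards whichever of [u] and [v] differs from
    [b]. *)
Lemma linked_ear U x y u v s : linked U -> u \in U -> v \in U -> u != v ->
  walk x y s -> uniq s -> (forall z, z \in s -> z \notin U) ->
  adj u x -> adj y v -> linked (U :|: [set z in s]).
Proof.
move=> lU uU vU uv ws us sU ux yv.
have half a b : a \in s -> b \in U ->
    exists2 t, walk a b t & [/\ uniq t, {subset t <= U :|: [set z in s]} & k <= size t].
  move=> as_ bU; case: (eqVneq b u) => [bu|bu].
    have vb : v != b by rewrite bu eq_sym.
    have [t wt [ut tU kt]] := lU _ _ vU bU vb.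
    move: (walk_rev ws) => wr.
    have [|s1 w1 [s1s us1]] := walk_prefix wr (z := a); first by rewrite mem_rev.
    have {}us1 : uniq s1 by apply: us1; rewrite rev_uniq.
    exists (rev s1 ++ t); first by apply: walk_cat (walk_rev w1) wt yv.
    split; last by rewrite size_cat; move: kt; clear; lia.
      apply: uniq_cat2; rewrite ?rev_uniq // => z; rewrite mem_rev => /s1s; rewrite mem_rev => /sU.
      by apply: contra => /tU.
    move=> z; rewrite mem_cat mem_rev !inE => /orP[/s1s|/tU->//].
    by rewrite mem_rev => ->; rewrite orbT.
  have ub : u != b by rewrite eq_sym.
  have [t wt [ut tU kt]] := lU _ _ uU bU ub.
  have [s1 w1 [s1s us1]] := walk_prefix ws as_; have {}us1 := us1 us.
  exists (rev s1 ++ t); first by apply: walk_cat (walk_rev w1) wt _; rewrite adj_sym.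
  split; last by rewrite size_cat; move: kt; clear; lia.
    apply: uniq_cat2; rewrite ?rev_uniq // => z; rewrite mem_rev => /s1s/sU.
    by apply: contra => /tU.
  by move=> z; rewrite mem_cat mem_rev !inE => /orP[/s1s->|/tU->//]; rewrite orbT.
have revt a b : (exists2 t, walk a b t & [/\ uniq t, {subset t <= U :|: [set z in s]} & k <= size t]) ->
    exists2 t, walk b a t & [/\ uniq t, {subset t <= U :|: [set z in s]} & k <= size t].
  move=> [t wt [ut tU kt]]; exists (rev t); first exact: walk_rev.
  by split; rewrite ?rev_uniq ?size_rev // => z; rewrite mem_rev => /tU.
move=> a b; rewrite !inE => /orP[aU|aS] /orP[bU|bS] ab.
- have [t wt [ut tU kt]] := lU _ _ aU bU ab; exists t => //; split=> // z /tU.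
  by rewrite !inE => ->.
- by apply: revt; apply: half.
- exact: half.
- have [s1 [s2 [w12 u12 s12]]] := walk_split2 ws us aS bS ab.
  have [t wt [ut tU kt]] := lU _ _ uU vU uv.
  have [u1 u2 d12] : [/\ uniq s1, uniq s2 & forall z, z \in s1 -> z \notin s2].
    move: u12; rewrite cat_uniq => /and3P[-> /hasPn d ->]; split=> // z z1.
    by apply/negP => /d /=; rewrite z1.
  have s1s z : z \in s1 -> z \in s by move=> z1; apply: s12; rewrite mem_cat z1.
  have s2s z : z \in s2 -> z \in s by move=> z1; apply: s12; rewrite mem_cat z1 orbT.
  have main a' b' : walk x a' s1 -> walk b' y s2 ->
      exists2 t, walk a' b' t & [/\ uniq t, {subset t <= U :|: [set z in s]} & k <= size t].
    move=> w1 w2; exists (rev s1 ++ t ++ rev s2).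
      apply: walk_cat (walk_rev w1) (walk_cat wt (walk_rev w2) _) _; by rewrite adj_sym.
    split; last by rewrite !size_cat; move: kt; clear; lia.
      apply: uniq_cat3; rewrite ?rev_uniq // => z.
      - by rewrite mem_rev => /s1s/sU; apply: contra => /tU.
      - by rewrite !mem_rev; apply: d12.
      - by rewrite mem_rev => /tU zU; apply/negP => /s2s/sU; rewrite zU.
    by move=> z; rewrite !mem_cat !mem_rev !inE => /or3P[/s1s->|/tU->|/s2s->]; rewrite ?orbT.
  by case: w12 => -[w1 w2]; [apply: main|apply: revt; apply: main].
Qed.

End LinkedSet.

(** Deleted vertices are banned by the relation, so walks stay in [G] instead of the subtype
    underlying [del_vertices S]. *)
Definition resists (G : sgraph) (k : nat) := forall S : {set G}, #|S| < k ->
  forall x y, x \notin S -> y \notin S ->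
  connect [rel u v | @adj G u v && (u \notin S) && (v \notin S)] x y.

Section Gates.
Variables (G : sgraph) (C U : {set G}).
Local Notation adj := (@adj G).
Implicit Types (x y z a b u v p : G) (s t w : seq G).

Definition outside z := (z \notin C) && (z \notin U).

Definition outside_rel := [rel a b | adj a b && outside a && outside b].

(** The components off C and [U] are read as branches at vertices of [U]; under [no_ear] each branch
    touches [U] in at most one vertex. *)
Definition hangs u z :=
  (z == u) || [exists y, [&& adj u y, outside y & connect outside_rel y z]].

(** Contracting every branch to its root turns disjoint connections from [U] to C into a matching of
    this bipartite relation, so Konig's theorem takes the place of Menger's. *)
Definition gates := [set e : G * G |
  [&& e.1 \in U, e.2 \in C & [exists z, hangs e.1 z && adj z e.2]]].

Hypothesis UC : forall u, u \in U -> u \notin C.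

Hypothesis no_ear : forall x y u v s, u \in U -> v \in U -> u != v -> walk x y s ->
  uniq s -> all outside s -> adj u x -> adj y v -> False.

Lemma outside_connect y z : outside y -> connect outside_rel y z -> outside z.
Proof.
move=> oy yz; have cl u v : outside u -> outside_rel u v -> outside v by move=> _ /= /andP[].
exact: connect_stable cl oy yz.
Qed.

Lemma outside_sym : connect_sym outside_rel.
Proof.
apply: sym_connect_sym => x y; rewrite /outside_rel /= adj_sym.
by case: (Defs.adj y x); case: (outside x); case: (outside y).
Qed.

Lemma hangs_inj u v z : u \in U -> v \in U -> hangs u z -> hangs v z -> u = v.
Proof.
move=> uU vU uz vz; apply/eqP/negPn/negP => uv.
case/orP: uz => [/eqP zu|/existsP[y /and3P[uy oy yz]]];
case/orP: vz => [/eqP zv|/existsP[y' /and3P[vy' oy' yz']]].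
- by move: uv; rewrite -zu zv eqxx.
- by have := outside_connect oy' yz'; rewrite /outside zu uU andbF.
- by have := outside_connect oy yz; rewrite /outside zv vU andbF.
have yy' : connect outside_rel y y' by rewrite (connect_trans yz) // outside_sym.
have [s ws [us os]] := connect_walk oy yy'.
by apply: (no_ear uU vU uv ws us os uy); rewrite adj_sym.
Qed.

Lemma gate_ext u v z w : hangs u z -> walk u v w -> uniq w ->
  (forall a, a \in w -> outside a -> ~~ hangs u a) ->
  exists2 w', walk z v w' & [/\ uniq w', size w <= size w' &
    forall a, a \in w' -> a \in w \/ outside a /\ hangs u a].
Proof.
case/orP=> [/eqP->|/existsP[y /and3P[uy oy yz]]] ww uw wo.
  by exists w => //; split=> // a; left.
have [s ws [us os]] := connect_walk oy yz.
have hs a : a \in s -> outside a /\ hangs u a.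
  move=> as_; split; first by move/allP: os => /(_ a as_).
  have [s1 w1 [s1s _]] := walk_prefix ws as_.
  apply/orP; right; apply/existsP; exists y; rewrite uy oy /=.
  by apply: walk_connect w1 _; apply/allP => b /s1s bs; move/allP: os => /(_ b bs).
exists (rev s ++ w).
  by apply: walk_cat (walk_rev ws) ww _; rewrite adj_sym.
split; last by move=> a; rewrite mem_cat mem_rev => /orP[/hs|]; [right|left].
  apply: uniq_cat2; rewrite ?rev_uniq // => a; rewrite mem_rev => /hs[oa ha].
  by apply/negP => /wo => /(_ oa); rewrite ha.
by rewrite size_cat leq_addl.
Qed.

(** Delete the covered vertices of [U] and of C. From an uncovered vertex of [U] one then reaches
    only what hangs on uncovered vertices of [U], since a step to C would use an uncovered gate. A
    cover below [k] would therefore separate [U] from C. *)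
Lemma gates_cover k (A B : {set G}) : resists G k -> edge_cover gates A B ->
  k <= #|U| -> k <= #|C| -> k <= #|A| + #|B|.
Proof.
move=> res cov kU kC; rewrite leqNgt; apply/negP => lt.
have [u uU uA] : exists2 u, u \in U & u \notin A.
  apply: NNPP => N; have : #|U| <= #|A|.
    by apply: subset_leq_card; apply/subsetP => u uU; apply/negPn/negP => uA; apply: N; exists u.
  by move: lt kU; clear; lia.
have [p pC pB] : exists2 p, p \in C & p \notin B.
  apply: NNPP => N; have : #|C| <= #|B|.
    by apply: subset_leq_card; apply/subsetP => q qC; apply/negPn/negP => qB; apply: N; exists q.
  by move: lt kC; clear; lia.
pose S := (A :&: U) :|: (B :&: C).
have lS : #|S| < k.
  apply: leq_ltn_trans lt; apply: leq_trans (leq_card_setU _ _) _.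
  by apply: leq_add; apply: subset_leq_card; apply: subsetIl.
have uS : u \notin S by rewrite !inE negb_or !negb_and uA (UC uU) orbT.
have pU : p \notin U by apply/negP => /UC; rewrite pC.
have pS : p \notin S by rewrite !inE negb_or !negb_and pB pU orbT.
pose X : pred G := fun v => [exists u', [&& u' \in U, u' \notin A & hangs u' v]].
suff : X p.
  case/existsP => u' /and3P[u'U _ /orP[/eqP pu|/existsP[y /and3P[_ oy yp]]]].
    by rewrite pu u'U in pU.
  by have := outside_connect oy yp; rewrite /outside pC.
apply: connect_stable (res S lS u p uS pS); last first.
  by apply/existsP; exists u; rewrite uU uA /hangs eqxx.
move=> a b /existsP[u' /and3P[u'U u'A ha]] /= /andP[/andP[ab aS] bS].
have nbC : b \notin C.
  apply/negP => bC; have : (u', b) \in gates.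
    by rewrite inE /= u'U bC; apply/existsP; exists a; rewrite ha ab.
  move/cov => /= [|bB]; first by rewrite (negbTE u'A).
  by move: bS; rewrite !inE bB bC orbT.
case: (boolP (b \in U)) => bU.
  case/orP: (ha) => [_|/existsP[y /and3P[uy oy ya]]].
    by apply/existsP; exists b; move: bS; rewrite !inE bU andbT negb_or => /andP[-> _]; rewrite /hangs eqxx.
  suff <- : u' = b by apply/existsP; exists u'; rewrite u'U u'A /hangs eqxx.
  apply: (hangs_inj u'U bU ha); apply/orP; right; apply/existsP; exists a.
  by rewrite adj_sym ab connect0 (outside_connect oy ya).
apply/existsP; exists u'; rewrite u'U u'A /=; apply/orP; right.
have ob : outside b by rewrite /outside nbC.
case/orP: ha => [/eqP au|/existsP[y /and3P[uy oy ya]]].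
  by apply/existsP; exists b; rewrite -au ab ob connect0.
have oa := outside_connect oy ya.
apply/existsP; exists y; rewrite uy oy /=; apply: connect_trans ya (connect1 _).
by rewrite /= ab ob oa.
Qed.

End Gates.

Section LinkedAttached.
Variables (G : sgraph) (f : nat -> G) (c k d : nat) (D : {set G}).
Local Notation adj := (@adj G).
Hypothesis ft : traversal f c.
Hypothesis fmax : forall s : seq G, 1 < size s -> uniq s -> cycle adj s -> size s <= c.
Hypothesis res : resists G k.
Hypothesis k_gt0 : 0 < k.
Hypothesis kc : k <= c.
Hypothesis degd : forall v : G, d <= degree v.
Hypothesis Doff : forall i, f i \notin D.
Hypothesis Dlinked : linked k D.
Hypothesis kD : k <= #|D|.
Hypothesis kD' : k = 1 \/ k < #|D|.

Theorem linked_degree_bound : k.+1 * d + 1 <= gorder G + k * k.-1.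
Proof.
pose C := [set v in seg f 0 c].
have inC i : f i \in C by rewrite inE mem_seg_full.
have CE v : v \in C -> exists2 i, i < c & v = f i.
  by rewrite inE => /segP[i /andP[_ ic] ->]; exists i.
have cardC : #|C| = c.
  have := uniq_seg ft 0 (leqnn c); move/card_uniqP; rewrite size_seg => cE.
  by rewrite -[RHS]cE; apply: eq_card => z; rewrite inE.
pose good (U : {set G}) := [/\ D \subset U, linked k U & forall u, u \in U -> u \notin C].
have goodD : good D.
  split=> // u uD; apply/negP => /CE[i _ E]; by have := Doff i; rewrite -E uD.
have [n [U [DU lU UC] Un] nmax] : exists2 n, (exists2 U, good U & #|U| = n) &
    forall m, (exists2 U, good U & #|U| = m) -> m <= n.
  apply: (@exists_maxP _ (gorder G)); first by exists #|D|; exists D.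
  by move=> m [U _ <-]; apply: max_card.
have kU : k <= #|U| by apply: leq_trans kD (subset_leq_card DU).
have no_ear x y u v s : u \in U -> v \in U -> u != v -> walk x y s ->
    uniq s -> all (outside C U) s -> adj u x -> adj y v -> False.
  move=> uU vU uv ws us /allP os ux yv.
  have sU z : z \in s -> z \notin U by move=> /os /andP[].
  have gU' : good (U :|: [set z in s]).
    split.
    - exact: subset_trans DU (subsetUl _ _).
    - exact: linked_ear lU uU vU uv ws us sU ux yv.
    - by move=> z; rewrite !inE => /orP[/UC|/os/andP[]]; rewrite inE.
  have := nmax _ (ex_intro2 _ _ _ gU' erefl); rewrite -Un leqNgt => /negP; apply.
  apply: proper_card; apply/properP; split; first exact: subsetUl.
  by exists x; [rewrite !inE (walk_head ws) orbT|apply: sU; apply: walk_head ws].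
have [M0 M0g [M0m kM0]] := konig (fun A B cov =>
  gates_cover UC no_ear res cov kU (eq_ind_r (leq k) kc cardC)).
have [M MM0 cardM] := subset_of_card kM0.
have Mm : is_matching M by move=> e e' eM e'M; apply: M0m; apply: (subsetP MM0).
have Mg e : e \in M -> [/\ e.1 \in U, e.2 \in C & exists2 z, hangs C U e.1 z & adj z e.2].
  move=> eM; have := subsetP M0g _ (subsetP MM0 _ eM); rewrite inE => /and3P[e1 e2 /existsP[z /andP[hz az]]].
  by split=> //; exists z.
(* An unmatched vertex of [U] becomes the further source. For [k = 1] walks on one vertex are long
   enough, so any vertex of [U] will do. *)
have [h hU hM] : exists2 h, h \in U & k = 1 \/ forall e, e \in M -> h != e.1.
  case: kD' => [k1|kD1].
    have /card_gt0P[u uU] : 0 < #|U| by apply: leq_trans kU.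
    by exists u => //; left.
  have lt : #|fst @: M| < #|U|.
    apply: leq_ltn_trans (leq_imset_card _ _) _; rewrite cardM.
    exact: leq_trans kD1 (subset_leq_card DU).
  have [h hU hn] : exists2 h, h \in U & h \notin fst @: M.
    apply: NNPP => N; move: lt; rewrite ltnNge => /negP; apply.
    by apply: subset_leq_card; apply/subsetP => u uU; apply/negPn/negP => un; apply: N; exists u.
  by exists h => //; right=> e eM; apply: contra hn => /eqP->; apply: imset_f.
pose offC : pred G := fun v => v \notin C.
pose e0 := [rel a b | adj a b && offC a && offC b].
pose H := [set v | connect e0 h v & v \notin C].
have e0s : connect_sym e0.
  apply: sym_connect_sym => x y; rewrite /e0 /= adj_sym.
  by case: (Defs.adj y x); case: (offC x); case: (offC y).
have hH : h \in H by rewrite inE connect0 UC.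
have walkH x y s : walk x y s -> (forall a, a \in s -> a \notin C) -> x \in H -> {subset s <= H}.
  move=> ws sC xH a as_; have [s1 w1 [s1s _]] := walk_prefix ws as_.
  rewrite inE sC // andbT; move: xH; rewrite inE => /andP[hx _]; apply: connect_trans hx _.
  by apply: walk_connect w1 _; apply/allP => b /s1s /sC.
have UH u : u \in U -> u \in H.
  move=> uU; case: (eqVneq h u) => [<-//|hu].
  have [s ws [us sU _]] := lU _ _ hU uU hu.
  apply: (walkH _ _ _ ws _ hH) (walk_last ws) => a /sU; exact: UC.
have Hcl a b : a \in H -> adj a b -> b \notin C -> b \in H.
  rewrite !inE => /andP[ha aC] ab bC; rewrite bC andbT; apply: connect_trans ha (connect1 _).
  by rewrite /= ab /offC !inE aC bC.
have hangH u a : u \in U -> hangs C U u a -> a \in H.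
  move=> uU /orP[/eqP->|/existsP[y /and3P[uy oy ya]]]; first exact: UH.
  have yH : y \in H by apply: Hcl (UH _ uU) uy _; case/andP: oy.
  apply: (@connect_stable _ (outside_rel C U) (fun v => v \in H)) ya => // a1 b1 a1H /= /andP[/andP[ab _] /andP[bC _]].
  exact: Hcl a1H ab bC.
have [e eM] : exists e, e \in M by apply/card_gt0P; rewrite cardM.
have [_ /CE[i0 i0c ei0] _] := Mg _ eM.
(* Starting right after a matched vertex of C puts that vertex at position c - 1, as [lastP]
   requires. *)
pose g i := f (i0.+1 + i).
have gt : traversal g c := trav_shift ft i0.+1.
have gC i : g i \in C by apply: inC.
(* The multiple [i0.+1 * c] of the period keeps the shift back by [i0.+1] from being truncated at
   0. *)
have Cg v : v \in C -> exists2 i : 'I_c, true & v = g i.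
  rewrite inE => /segP[i _ ->]; have := mem_seg_full gt 0 (i + i0.+1 * c - i0.+1).
  have -> : g (i + i0.+1 * c - i0.+1) = f i.
    rewrite /g (_ : i0.+1 + _ = i0.+1 * c + i); last first.
      have : i0.+1 <= i0.+1 * c by apply: leq_pmulr; move: (trav_gt1 ft); clear; lia.
      by clear; lia.
    by rewrite -(trav_mod ft) modnMDl (trav_mod ft).
  by move=> /segP[j /andP[_ jc] ->]; exists (Ordinal jc).
pose P := [set i : 'I_c | g i \in snd @: M].
have cardP : #|P| = k.
  rewrite -cardM -(@card_in_imset _ _ snd (mem M)); last first.
    by move=> a b aM bM ab; apply: Mm => //; right.
  rewrite -(@card_in_imset _ _ (fun i : 'I_c => g i) (mem P)); last first.
    by move=> x y _ _ E; apply: val_inj; case: gt => _ _ _ gi; exact: gi (ltn_ord x) (ltn_ord y) E.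
  apply: eq_card => v; apply/imsetP/imsetP => [[i]|[a aM va]].
    by rewrite inE => /imsetP[a aM ga] ->; exists a.
  have [_ aC _] := Mg _ aM; have [i _ E] := Cg _ aC.
  by exists i; rewrite ?inE -?E ?va //; apply: imset_f.
have gate_of p : p \in P -> exists u z, [/\ (u, g p) \in M, u \in U, hangs C U u z & adj z (g p)].
  rewrite inE => /imsetP[[u q] aM /= E]; have [uU _ [z hz az]] := Mg _ aM.
  by exists u, z; rewrite E.
have Uo a : a \in U -> ~~ outside C U a by move=> aU; rewrite /outside aU andbF.
have ext u v z w : u \in U -> hangs C U u z -> walk u v w -> uniq w -> (forall a, a \in w -> a \in U) ->
    exists2 w', walk z v w' & [/\ uniq w', size w <= size w' &
    forall a, a \in w' -> a \in U \/ outside C U a /\ hangs C U u a].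
  move=> uU hz ww uw wU; have [|w' ww' [uw' sw' aw']] := gate_ext hz ww uw.
    by move=> a /wU/Uo /negbTE->.
  exists w' => //; split=> // a /aw'[/wU|]; [by left|by right].
have PHh : forall p, p \in P -> exists x s,
    [/\ walk x h s, uniq s, {subset s <= H}, adj (g p) x & k <= size s].
  move=> p /gate_of[u [z [uM uU hz az]]].
  have [w ww [uw wU kw]] : exists2 w, walk u h w & [/\ uniq w, {subset w <= U} & k <= size w].
    case: (eqVneq u h) => [E|uh]; last exact: lU.
    have k1 : k = 1 by case: hM => // hM; have := hM _ uM; rewrite /= E eqxx.
    by exists [:: u]; [rewrite -E walk1|rewrite k1; split=> // a; rewrite inE => /eqP->].
  have [w' ww' [uw' sw' aw']] := ext _ _ _ _ uU hz ww uw wU.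
  exists z, w'; split=> //; [|by rewrite adj_sym|exact: leq_trans kw sw'].
  by move=> a /aw'[/UH//|[_ /(hangH _ _ uU)]].
have PPh : forall p q, p \in P -> q \in P -> p != q -> exists x y s,
    [/\ walk x y s, uniq s, {subset s <= H}, adj (g p) x /\ adj y (g q) & k <= size s].
  move=> p q pP qP pq.
  have [u [z [uM uU hz az]]] := gate_of _ pP; have [v [y [vM vU hy ay]]] := gate_of _ qP.
  have uv : u != v.
    apply/eqP => E; subst v; have [] := Mm _ _ uM vM (or_introl erefl) => gE.
    case: gt => _ _ _ gi; move: pq; rewrite (_ : p = q) ?eqxx //; apply: val_inj.
    exact: gi (ltn_ord p) (ltn_ord q) gE.
  have [w ww [uw wU kw]] := lU _ _ uU vU uv.
  have [w1 ww1 [uw1 sw1 aw1]] := ext _ _ _ _ uU hz ww uw wU.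
  (* The walk is prolonged at [z], reversed, and prolonged at [y]; the branches at [u] and [v] are
     disjoint by [hangs_inj], so the two prolongations do not meet. *)
  have [|w2 ww2 [uw2 sw2 aw2]] := gate_ext hy (walk_rev ww1) (etrans (rev_uniq _) uw1).
    move=> a; rewrite mem_rev => /aw1[/Uo/negbTE->//|[oa ha] _].
    by apply/negP => hva; move: uv; rewrite (hangs_inj no_ear uU vU ha hva) eqxx.
  exists z, y, (rev w2); split; rewrite ?rev_uniq ?size_rev //.
  - exact: walk_rev.
  - move=> a; rewrite mem_rev => /aw2[|[_ /(hangH _ _ vU)//]].
    by rewrite mem_rev => /aw1[/UH//|[_ /(hangH _ _ uU)//]].
  - by rewrite adj_sym.
  - by apply: leq_trans kw (leq_trans sw1 _); rewrite -(size_rev w1).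
have Hoff i : g i \notin H by rewrite inE gC andbF.
have Hconn u v : u \in H -> v \in H -> exists2 s, walk u v s & uniq s /\ {subset s <= H}.
  move=> uH vH; move: (uH) (vH); rewrite [u \in H]inE [v \in H]inE => /andP[hu uC] /andP[hv vC].
  have uv : connect e0 u v by rewrite (connect_trans _ hv) // e0s.
  have [s ws [us sC]] := @connect_walk G offC u v uC uv.
  exists s => //; split=> //; apply: walkH ws _ uH.
  by move=> a as_; move/allP: sC => /(_ a as_).
have Hclosed u v : u \in H -> adj u v -> (forall i, g i != v) -> v \in H.
  move=> uH uv vg; apply: Hcl uH uv _; apply/negP => /Cg[i _ E].
  by have := vg i; rewrite E eqxx.
have lastP : exists2 p : 'I_c, p \in P & p.+1 = c.
  have c1 := trav_gt1 ft; have lc : c.-1 < c by move: c1; clear; lia.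
  exists (Ordinal lc); last by rewrite /=; move: c1; clear; lia.
  rewrite inE /g /= (_ : i0.+1 + c.-1 = i0 + c); last by move: c1; clear; lia.
  by case: ft => _ _ -> _; rewrite -ei0; apply: imset_f.
exact: (attachments_degree_bound gt fmax cardP hH Hoff Hconn Hclosed PHh PPh lastP degd).
Qed.

End LinkedAttached.

(** * Sets of positions on a cycle *)

Section CyclicSets.
Variable r : nat.
Implicit Types (i j v w x : 'I_r) (X Y M N : {set 'I_r}).

Definition cdist (i j : nat) := if i <= j then minn (j - i) (r - (j - i)) else minn (i - j) (r - (i - j)).

Definition offset (v x : nat) := if v <= x then x - v else x + r - v.

Lemma cdist_sym i j : cdist i j = cdist j i.
Proof. by rewrite /cdist; do 2!case: ifP; lia. Qed.

Lemma cdist_bound i j : i != j -> 0 < cdist i j /\ 2 * cdist i j <= r.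
Proof.
move=> ij; have ne : (i : nat) <> j by move/val_inj => E; rewrite E eqxx in ij.
move: ne (ltn_ord i) (ltn_ord j); rewrite /cdist; clear; case: ifP; lia.
Qed.

(** This is X + {0, ..., t - 1} modulo r. The intervals are one-sided so that sets at distance [t]
    already have disjoint blow-ups. *)
Definition blow t X := [set x : 'I_r | [exists v, (v \in X) && (offset v x < t)]].

Lemma blow_disjoint t X Y : (forall v w, v \in X -> w \in Y -> t <= cdist v w) ->
  [disjoint blow t X & blow t Y].
Proof.
move=> tXY; rewrite -setI_eq0; apply/eqP/setP => x; rewrite !inE; apply/negbTE.
apply/negP => /andP[/existsP[v /andP[vX vx]] /existsP[w /andP[wY wx]]].
have := tXY _ _ vX wY; move: vx wx (ltn_ord v) (ltn_ord w) (ltn_ord x).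
rewrite /offset /cdist; clear; do 3!case: ifP; lia.
Qed.

Lemma sub_blow t X : 0 < t -> X \subset blow t X.
Proof.
move=> t0; apply/subsetP => x xX; rewrite inE; apply/existsP; exists x.
by rewrite xX /offset leqnn subnn.
Qed.

Lemma blow_mono t X : blow t X \subset blow t.+1 X.
Proof.
apply/subsetP => x; rewrite !inE => /existsP[v /andP[vX vx]]; apply/existsP; exists v.
by rewrite vX ltnW.
Qed.

(** A blow-up that stops growing is closed under taking the next position, hence is everything. *)
Lemma card_blow_step t X : 0 < t -> X != set0 -> blow t X != setT ->
  #|blow t X| < #|blow t.+1 X|.
Proof.
move=> t0 X0 Xf; apply: proper_card; apply/properP; split; first exact: blow_mono.
apply: NNPP => N; move/eqP: Xf; apply; apply/setP => y; rewrite in_setT.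
have [v vX] : exists v, v \in X by apply/set0Pn.
have step n (x : 'I_r) : offset v x = n -> x \in blow t X.
  elim: n x => [|n IH] x xn.
    apply: (subsetP (sub_blow X t0)); rewrite (_ : x = v) //; apply: val_inj.
    by move: xn (ltn_ord x) (ltn_ord v); rewrite /offset /=; clear; case: ifP; lia.
  have xpr : (if val x == 0 then r.-1 else x.-1) < r.
    by have := ltn_ord x; clear; case: ifP; lia.
  have xp : Ordinal xpr \in blow t X.
    apply: IH; move: xn (ltn_ord x) (ltn_ord v); rewrite /offset /=; clear.
    by do 3!case: ifP; lia.
  apply/negPn/negP => xb; apply: N; exists x => //.
  move: xp; rewrite !inE => /existsP[w /andP[wX wx]]; apply/existsP; exists w; rewrite wX /=.
  move: wx (ltn_ord x) (ltn_ord w); rewrite /offset /=; clear.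
  by do 3!case: ifP; lia.
exact: (step _ y erefl).
Qed.

(** A sumset bound of Cauchy-Davenport type, valid modulo any r because one summand is an
    interval. *)
Lemma card_blow t X : X != set0 -> blow t.+1 X != setT -> #|X| + t <= #|blow t.+1 X|.
Proof.
move=> X0; elim: t => [|t IH] bt; first by rewrite addn0 subset_leq_card ?sub_blow.
have bt' : blow t.+1 X != setT.
  by apply: contraNneq bt => E; rewrite eqEsubset subsetT -E blow_mono.
by have := card_blow_step (ltn0Sn t) X0 bt'; have := IH bt'; clear; lia.
Qed.

Lemma card_blow1 t v : t <= r -> t <= #|blow t [set v]|.
Proof.
case: t => // t tr; case: (eqVneq (blow t.+1 [set v]) setT) => [->|ne].
  by rewrite cardsT card_ord.
have := @card_blow t [set v] _ ne; rewrite cards1 add1n; apply.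
by apply/set0Pn; exists v; rewrite inE.
Qed.

Lemma card_blow_sparse t X : t <= r ->
  (forall v w, v \in X -> w \in X -> v != w -> t <= cdist v w) -> t * #|X| <= #|blow t X|.
Proof.
move=> tr; move: {2}#|X| (erefl #|X|) => n; elim: n X => [|n IH] X Xn sp.
  by rewrite Xn muln0.
have [v vX] : exists v, v \in X by apply/card_gt0P; rewrite Xn.
have cX : #|X :\ v| = n by move: (cardsD1 v X); rewrite vX Xn add1n => -[].
have sp' u w : u \in X :\ v -> w \in X :\ v -> u != w -> t <= cdist u w.
  by rewrite !inE => /andP[_ uX] /andP[_ wX]; apply: sp.
have IH' := IH _ cX sp'; rewrite cX in IH'; rewrite Xn mulnS.
apply: leq_trans (leq_add (card_blow1 v tr) IH') _.
have dj : [disjoint blow t [set v] & blow t (X :\ v)].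
  apply: blow_disjoint => a b; rewrite !inE => /eqP-> /andP[bv bX]; apply: sp => //.
  by rewrite eq_sym.
rewrite -(leq_card_setU _ _).2 in dj; rewrite -(eqP dj); apply: subset_leq_card.
apply/subsetP => x; rewrite !inE => /orP[] /existsP[w /andP[+ wx]]; rewrite ?inE.
  by move=> /eqP E; apply/existsP; exists v; rewrite vX -E wx.
by move=> /andP[_ wX]; apply/existsP; exists w; rewrite wX wx.
Qed.

(* The t-blow-ups of the common part and of the two differences are disjoint. *)
Lemma close_pair M N : M != set0 -> N != set0 -> ~ (exists v, M = [set v] /\ N = [set v]) ->
  exists i j, [/\ i \in M, j \in N, i != j &
    cdist i j <= 1 \/ 2 * cdist i j + #|M| + #|N| <= r + 4].
Proof.
move=> M0 N0 ns.
have [x xM] : exists v, v \in M by apply/set0Pn.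
have [y yN] : exists v, v \in N by apply/set0Pn.
pose Q (e : 'I_r * 'I_r) := [&& e.1 \in M, e.2 \in N & e.1 != e.2].
have [e0 Qe0] : exists e, Q e.
  case: (eqVneq x y) => [E|ne]; last by exists (x, y); rewrite /Q /= xM yN.
  apply: NNPP => H; apply: ns; exists x; split; apply/setP => z; rewrite inE.
    apply/idP/eqP => [zM|->//]; apply/eqP/negPn/negP => zx.
    by apply: H; exists (z, y); rewrite /Q /= zM yN -E.
  apply/idP/eqP => [zN|->]; last by rewrite E.
  by apply/eqP/negPn/negP => zx; apply: H; exists (x, z); rewrite /Q /= xM zN eq_sym.
case: (@arg_minnP _ e0 Q (fun e => cdist e.1 e.2) Qe0) => -[i j] /and3P[/= iM jN ij] tmin.
exists i, j; split=> //; set t := cdist i j in tmin *.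
case: (leqP t 1) => t2; [by left|right].
have [_ tr2] := cdist_bound ij; rewrite -/t in tr2.
have tm v w : v \in M -> w \in N -> v != w -> t <= cdist v w.
  by move=> vM wN vw; apply: (tmin (v, w)); rewrite /Q /= vM wN.
pose I := M :&: N; pose A := M :\: N; pose B := N :\: M.
have dIA : [disjoint blow t I & blow t A].
  apply: blow_disjoint => v w; rewrite !inE => /andP[vM vN] /andP[wN wM]; rewrite cdist_sym.
  by apply: tm => //; apply: contraNneq wN => ->.
have dIB : [disjoint blow t I & blow t B].
  apply: blow_disjoint => v w; rewrite !inE => /andP[vM vN] /andP[wM wN].
  by apply: tm => //; apply: contraNneq wM => <-.
have dAB : [disjoint blow t A & blow t B].
  apply: blow_disjoint => v w; rewrite !inE => /andP[vN vM] /andP[wM wN].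
  by apply: tm => //; apply: contraNneq wM => <-.
have dI : #|blow t I| >= t * #|I|.
  apply: card_blow_sparse; first by move: tr2; clear; lia.
  by move=> v w; rewrite !inE => /andP[vM _] /andP[_ wN]; apply: tm.
have tot : #|blow t I| + #|blow t A| + #|blow t B| <= r.
  rewrite -[X in _ <= X]card_ord.
  move: dIA dIB dAB; rewrite -!(leq_card_setU _ _).2 => /eqP E1 E2 E3.
  rewrite -E1; have dU : [disjoint blow t I :|: blow t A & blow t B].
    move: E2 E3; rewrite !(leq_card_setU _ _).2 -!setI_eq0 => /eqP E2 /eqP E3.
    by rewrite setIUl E2 E3 setU0.
  by move: dU; rewrite -(leq_card_setU _ _).2 => /eqP <-; apply: max_card.
have ne X : X != set0 -> blow t X != set0.
  move=> /set0Pn[v vX]; apply/set0Pn; exists v.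
  by apply: (subsetP (sub_blow _ _)) vX; move: t2; clear; lia.
have bl X : X != set0 -> #|blow t X| < r -> #|X| + t.-1 <= #|blow t X|.
  move=> X0 lt; have tE : t = t.-1.+1 by move: t2; clear; lia.
  rewrite {2}tE; apply: card_blow; rewrite // -tE.
  by apply: contraTneq lt => ->; rewrite cardsT card_ord ltnn.
have cM : #|M| = #|I| + #|A| by rewrite /I /A cardsID.
have cN : #|N| = #|I| + #|B| by rewrite /I /B setIC cardsID.
have M1 : 0 < #|M| by rewrite card_gt0.
have N1 : 0 < #|N| by rewrite card_gt0.
have bA : 0 < #|A| -> #|A| + t.-1 <= #|blow t A|.
  rewrite card_gt0 => A0; apply: bl => //.
  have : 0 < #|blow t I| + #|blow t B|.
    move: N1; rewrite cN !addn_gt0 => /orP[] ; rewrite !card_gt0 => /ne ->; rewrite ?orbT //.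
  by move: tot; clear; lia.
have bB : 0 < #|B| -> #|B| + t.-1 <= #|blow t B|.
  rewrite card_gt0 => B0; apply: bl => //.
  have : 0 < #|blow t I| + #|blow t A|.
    move: M1; rewrite cM !addn_gt0 => /orP[] ; rewrite !card_gt0 => /ne ->; rewrite ?orbT //.
  by move: tot; clear; lia.
have ns' : 1 < #|M| + #|N| - #|I|.
  rewrite -cardsU; apply/card_gt1P; exists i, j; split=> //; rewrite inE ?iM ?jN ?orbT //.
move: cM cN tot dI bA bB M1 N1 t2 ns'.
move: #|blow t I| #|blow t A| #|blow t B| #|I| #|A| #|B| #|M| #|N| (t) => bi ba bb ci ca cb cm cn t' {t tmin tr2 tm dIA dIB dAB ne bl}.
move=> -> -> tot dI bA bB M1 N1 t2 ns'.
(* These are (t - 2)(c - 2) >= 0, (t - 2)(c - 1) >= 0 and (t - 2)c >= 0 for the size c of the common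
   part; they serve the cases where none, one or both of the two differences are nonempty. *)
have H1 : 0 < ci -> 2 * t' + 2 * ci <= t' * ci + 4 \/ ci = 1.
  by clear -t2; case: ci => [|[|ci]] //; [right|left; nia].
have H2 : 0 < ci -> t' + 2 * ci <= t' * ci + 3 by clear -t2; nia.
have H3 : 0 < ci -> 2 * ci <= t' * ci by clear -t2; nia.
move: H1 H2 H3 dI; move: (t' * ci) => tc; clear - tot bA bB M1 N1 t2 ns'.
move=> H1 H2 H3 dI.
case: (posnP ci) => [i0|i0]; last have [{}H1 [{}H2 {}H3]] := (H1 i0, (H2 i0, H3 i0)).
  have ca0 : 0 < ca by lia. have cb0 : 0 < cb by lia.
  by move: (bA ca0) (bB cb0); clear -tot i0 t2; lia.
case: (posnP ca) => [a0|/[dup] a0 /bA {}bA]; case: (posnP cb) => [b0|/[dup] b0 /bB {}bB].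
- by clear bA bB; case: H1; lia.
- by clear bA; lia.
- by clear bB; lia.
- lia.
Qed.

(** The term [2 * r] on the left has two uses. Being at least |M| + |N|, it gives the plain bound
    2(r + 1)(|M| + |N|) <= 4rg; kept as it is, it is a surplus 2r(r + 1) that buys one
    representative. *)
Lemma gap_bound M N g : M != set0 -> N != set0 -> ~ (exists v, M = [set v] /\ N = [set v]) ->
  (forall i j, i \in M -> j \in N -> i != j -> r + 2 <= g + cdist i j) ->
  (r.+1) * (2 * r + #|M| + #|N|) <= 4 * r * g.
Proof.
move=> M0 N0 ns gb; have [i [j [iM jN ij ts]]] := close_pair M0 N0 ns.
have := gb _ _ iM jN ij; have [t0 tr] := cdist_bound ij.
have : #|M| <= r by rewrite -[X in _ <= X]card_ord max_card.
have : #|N| <= r by rewrite -[X in _ <= X]card_ord max_card.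
have : 0 < #|M| by rewrite card_gt0.
have : 0 < #|N| by rewrite card_gt0.
move: ts t0 tr; move: #|M| #|N| (cdist i j) => p q t; clear => ts t0 tr q0 p0 qr pr gt.
case: (leqP t 1) => t1.
  have g1 : r.+1 <= g by lia.
  have : r.+1 * (2 * r + p + q) <= r.+1 * (4 * r) by rewrite leq_mul2l; lia.
  by nia.
have {}ts : 2 * t + p + q <= r + 4 by lia.
have r4 : 4 <= r by lia.
(* With s = p + q the inequality (r + 1)(2r + s) <= 2r(r + s) holds from s = 3 on. For two
   singletons the gap is estimated by 2t <= r instead. *)
case: (leqP (p + q) 2) => pq.
  have g1 : r + 4 <= 2 * g by lia.
  have -> : p = 1 by lia. have -> : q = 1 by lia.
  by clear -g1 r4; nia.
have g1 : r + (p + q) <= 2 * g by lia.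
have : 2 * r * (r + (p + q)) <= 2 * r * (2 * g) by rewrite leq_mul2l g1 orbT.
rewrite -!addnA; move: (p + q) pq => s s3; clear -r4 s3; nia.
Qed.

End CyclicSets.

Lemma last_before (P : pred nat) b : 0 < b -> P 0 ->
  exists a, [/\ a < b, P a & forall u, a < u < b -> ~~ P u].
Proof.
move=> b0 P0; have [a [ab Pa] amax] := @exists_maxP (fun a => a < b /\ P a) b
  (ex_intro _ 0 (conj b0 P0)) (fun n '(conj h _) => ltnW h).
exists a; split=> // u /andP[au ub]; apply/negP => Pu.
by have := amax u (conj ub Pu); rewrite leqNgt au.
Qed.

(* B accumulates a bonus along the points where w is positive. *)
Lemma cyclic_sum (K L c : nat) (w B : nat -> nat) : 0 < w 0 -> w c = w 0 -> B 0 = 0 ->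
  (exists2 u, 0 < u < c & 0 < w u) ->
  (forall a b, a < b -> b <= c -> b < a + c -> 0 < w a -> 0 < w b ->
    (forall u, a < u < b -> w u = 0) -> L * (w a + w b) + B b <= K * (b - a) + B a) ->
  2 * L * \sum_(u < c) w u + B c <= K * c.
Proof.
move=> w0 wc B0 [u1 u1c wu1] step.
pose W b := \sum_(u < b) w u.
have zero a b : a < b -> (forall u, a < u < b -> w u = 0) -> W b = W a + w a.
  move=> ab z; rewrite /W -!(big_mkord predT w) (big_cat_nat (leq0n a) (ltnW ab)) /=.
  rewrite (big_ltn ab) [X in _ + (_ + X)]big_nat_cond [X in _ + (_ + X)]big1 ?addn0 // => i /andP[/andP[ai ib] _].
  by apply: z; rewrite ai.
(* Every gap charges both of its ends: up to [b] all weights before [b] count twice, except that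
   [w 0] counts once, and [w b] has counted once so far. At [c] the two ends merge. *)
have claim b : b <= c -> 0 < w b -> L * (2 * W b + w b) + B b <= K * b + L * w 0.
  elim/ltn_ind: b => b IH bc wb; case: (posnP b) => [->|b0].
    by rewrite /W big_ord0 B0; clear; lia.
  have [a [ab wa amax]] := @last_before (fun u => 0 < w u) b b0 w0.
  have bac : b < a + c.
    rewrite ltn_neqAle (leq_trans bc (leq_addl _ _)) andbT.
    apply/eqP => E; have a0 : a = 0 by move: E bc; clear; lia.
    by have := amax u1; rewrite a0 wu1 => /(_ _)/negP; apply; move: E u1c; rewrite a0; clear; lia.
  have z u : a < u < b -> w u = 0 by move=> /amax; rewrite -eqn0Ngt => /eqP.
  have := step _ _ ab bc bac wa wb z; have := IH a ab (ltnW (leq_trans ab bc)) wa.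
  rewrite (zero _ _ ab z); move: (W a) (w a) (w b) (B a) (B b) => Wa wa' wb' Ba Bb.
  have -> : K * b = K * a + K * (b - a) by rewrite -mulnDr subnKC // ltnW.
  by clear; nia.
have c0 : 0 < c by move: u1c; clear; lia.
have := claim c (leqnn c); rewrite wc => /(_ w0); rewrite -/(W c); clear; nia.
Qed.

Section Attached.
Variables (r c : nat) (M : nat -> {set 'I_r}).
Hypothesis r1 : 0 < r.
Hypothesis Mc : M c = M 0.
Hypothesis far : forall u v i j, u < v -> v < u + c -> i \in M u -> j \in M v -> i != j ->
  r + 2 <= v - u + cdist r i j.
Hypothesis apart : forall u v, u < v -> v < u + c -> M u != set0 -> M v != set0 -> 2 <= v - u.

Definition same_singleton (X Y : {set 'I_r}) := exists v, X = [set v] /\ Y = [set v].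

Lemma step_bound u v : u < v -> v < u + c -> M u != set0 -> M v != set0 ->
  ~ same_singleton (M u) (M v) ->
  r.+1 * (2 * r + #|M u| + #|M v|) <= 4 * r * (v - u).
Proof. by move=> uv vc Mu Mv ns; apply: gap_bound => // i j iM jM ij; apply: far. Qed.

(** For equal singletons the gap may be as small as 2, which still pays for its two ends because r
    >= 1. *)
Lemma step_bound_same u v : u < v -> v < u + c -> M u != set0 -> M v != set0 ->
  2 * r.+1 * (#|M u| + #|M v|) <= 4 * r * (v - u).
Proof.
move=> uv vc Mu Mv; case: (classic (same_singleton (M u) (M v))) => [[x [-> ->]]|ns].
  rewrite !cards1; have := apart uv vc Mu Mv; move: (v - u) r1 => g; clear; nia.
have := step_bound uv vc Mu Mv ns.
have : #|M u| <= r by rewrite -[X in _ <= X]card_ord max_card.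
have : #|M v| <= r by rewrite -[X in _ <= X]card_ord max_card.
move: #|M u| #|M v| (4 * r * _) => p q g; clear; nia.
Qed.

Lemma attached_sum : M 0 != set0 -> (exists2 u, 0 < u < c & M u != set0) ->
  r.+1 * \sum_(u < c) #|M u| <= r * c.
Proof.
move=> M0 [u0 u0c Mu0].
have := @cyclic_sum (4 * r) (2 * r.+1) c (fun u => #|M u|) (fun=> 0).
rewrite card_gt0 M0 Mc => /(_ isT erefl erefl).
have ex : exists2 u, 0 < u < c & 0 < #|M u| by exists u0; rewrite ?card_gt0.
move=> /(_ ex); rewrite addn0 => H; have {}H : 2 * (2 * r.+1) * \sum_(u < c) #|M u| <= 4 * r * c.
  apply: H => a b ab bc bac; rewrite !card_gt0 => Ma Mb _; rewrite !addn0.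
  exact: step_bound_same.
by move: (\sum_(u < c) _) H => S; clear; nia.
Qed.

(* A partial system of distinct representatives of the sets M u. *)
Variable e : nat -> option 'I_r.
Hypothesis eM : forall u v, e u = Some v -> v \in M u.
Hypothesis einj : forall u v x, u < v -> v <= c -> e u = Some x -> e v = Some x -> u = 0 /\ v = c.
Variable x0 : 'I_r.
Hypothesis e0 : e 0 = Some x0.
Hypothesis ec : e c = Some x0.
Hypothesis e_more : exists2 u, 0 < u < c & e u.

Fixpoint latest n := if n is n'.+1 then (if e n is Some v then v else latest n') else x0.

(** The count starts at 1: positions 0 and [c] are the same vertex, which is counted at [c]. *)
Definition chosen n := \sum_(1 <= u < n.+1) e u.

Lemma latestP n : exists p, [/\ p <= n, e p = Some (latest n) & forall q, p < q <= n -> e q = None].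
Proof.
elim: n => [|n [p [pn ep pq]]]; first by exists 0; split=> // q; case: q.
rewrite /=; case E: (e n.+1) => [v|].
  by exists n.+1; split=> // q; case: ltngtP.
exists p; split=> // [|q /andP[pq' qn]]; first exact: leqW.
by case: (ltngtP q n.+1) qn => // [qn _|-> _//]; apply: pq; rewrite pq'.
Qed.

Lemma attached_sum_bonus :
  r.+1 * (\sum_(u < c) #|M u| + r * chosen c) <= 2 * r * c.
Proof.
have [u0 u0c eu0] := e_more.
have eM' u : e u -> M u != set0.
  by case E: (e u) => [v|] // _; apply/set0Pn; exists v; apply: eM.
(* Every gap except one between equal singletons has the surplus 2r(r + 1), the price of one
   representative. Such a gap need not be the one just before the next representative: it may occur
   earlier, where the latest one drops out of [M]. The boolean records that the next representative
   has then been paid for in advance. *)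
pose B n := 2 * r * r.+1 * (chosen n + (latest n \notin M n)).
have M0 : M 0 != set0 by apply: eM'; rewrite e0.
have ex : exists2 u, 0 < u < c & 0 < #|M u| by exists u0; rewrite ?card_gt0 ?eM'.
have B0 : B 0 = 0 by rewrite /B /chosen big_geq // /= (eM e0) muln0.
have := @cyclic_sum (4 * r) r.+1 c (fun u => #|M u|) B.
rewrite card_gt0 M0 Mc => /(_ isT erefl B0 ex) H.
have Bc : B c = 2 * r * r.+1 * chosen c.
  rewrite /B (_ : latest c = x0) ?Mc ?(eM e0) ?addn0 //.
  by case: (c) ec => // c' /=; move=> ->.
rewrite Bc in H.
suff H' : 2 * r.+1 * \sum_(u < c) #|M u| + 2 * r * r.+1 * chosen c <= 4 * r * c.
  by move: (\sum_(u < c) _) (chosen c) H' => S s; clear; nia.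
apply: H => a b ab bc bac; rewrite !card_gt0 => Ma Mb z.
have nz u : a < u < b -> e u = None.
  move=> aub; case E: (e u) => [v|] //; have := z _ aub => /eqP; rewrite cards_eq0.
  by rewrite (negbTE (eM' _ _)) // E.
have sB := step_bound_same ab bac Ma Mb.
have nB := step_bound ab bac Ma Mb.
case: b ab bc bac Mb z nz sB nB => // b ab bc bac Mb z nz sB nB.
have lat n : a <= n <= b -> latest n = latest a /\ chosen n = chosen a.
  elim: n => [|n IH] /andP[an nb]; first by have -> : a = 0 by move: an; clear; lia.
  case: (ltngtP a n.+1) an => // [an _|->//].
  have [|E1 E2] := IH; first by move: an nb; clear; lia.
  rewrite /chosen big_nat_recr //= -/(chosen n) nz; last by move: an nb; clear; lia.
  by rewrite E1 E2 addn0.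
have [lb cb] : latest b = latest a /\ chosen b = chosen a by apply: lat; rewrite -ltnS ab leqnn.
have chS : chosen b.+1 = chosen a + e b.+1.
  by rewrite /chosen big_nat_recr //= -/(chosen b) cb.
have ltS : latest b.+1 = if e b.+1 is Some v then v else latest a by rewrite /= lb.
set v := latest a in lb ltS *.
(* Equal singletons would make [b.+1] choose the latest representative once more. By [einj] this
   happens only from 0 all the way round to [c], which [e_more] excludes. *)
have key : (v \in M a) -> (e b.+1 \/ v \notin M b.+1) -> ~ same_singleton (M a) (M b.+1).
  move=> va + [y [Ea Eb]]; rewrite Ea inE in va; rewrite (eqP va).
  case; last by rewrite Eb inE eqxx.
  case E: (e b.+1) => [v'|] // _; have := eM E; rewrite Eb inE => /eqP E'.
  have [p [pa ep pq]] := latestP a; rewrite -/v (eqP va) in ep.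
  have [p0 bc'] : p = 0 /\ b.+1 = c.
    by apply: (einj (x := y)) => //; [exact: leq_ltn_trans pa ab|rewrite E E'].
  have u0a : u0 <= a.
    rewrite leqNgt; apply/negP => au0; move: eu0; rewrite nz //.
    by move: au0 u0c bc'; clear; lia.
  by move: eu0; rewrite pq // p0 u0a andbT; case/andP: u0c.
have main : r.+1 * (#|M a| + #|M b.+1|) <= 4 * r * (b.+1 - a).
  by move: sB; move: (4 * r * _) (_ + _) => g s; clear; nia.
have nonb : B b.+1 <= B a \/ (~ same_singleton (M a) (M b.+1) /\ B b.+1 <= B a + 2 * r * r.+1).
  rewrite /B chS ltS -/v; case: (boolP (v \in M a)) => va.
    case E: (e b.+1) => [v'|]; rewrite ?(eM E) /=.
      by right; split; [apply: key => //; left; rewrite E|rewrite !addn0 -mulnSr addn1].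
    case: (boolP (v \in M b.+1)) => vb; first by left; rewrite !addn0.
    by right; split; [apply: key => //; right|rewrite !addn0 -mulnSr addn1].
  left; rewrite leq_mul2l; apply/orP; right.
  by case E: (e b.+1) => [v'|]; rewrite ?(eM E) /= ?addn0 // leq_add2l; case: (_ \notin _).
case: nonb => [le|[ns le]]; first by move: main le; clear; lia.
have := nB ns; move: le; move: (B a) (B b.+1) #|M a| #|M b.+1| (4 * r * _) => Ba Bb p q g; clear; nia.
Qed.

End Attached.

(** * Extension systems of a cycle *)

Section TraversalDistance.
Variables (G : sgraph) (A : pred G) (g : nat -> G) (r : nat).
Local Notation adj := (@adj G).
Hypothesis gt : traversal g r.

Lemma walk_glue (x y z : G) s t : walk x y s -> walk y z t -> walk x z (s ++ behead t).
Proof.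
case: s => // a s /= /and3P[/eqP-> p1 /eqP l1]; case: t => // b t /= /and3P[/eqP E p2 /eqP l2].
by subst b; rewrite eqxx cat_path p1 last_cat l1 p2 l2 eqxx.
Qed.

Lemma long_arc (i j : 'I_r) : i != j -> exists2 s, walk (g i) (g j) s &
  [/\ uniq s, {subset s <= seg g 0 r} & r < size s + cdist r i j].
Proof.
wlog ij : i j / i < j => [H|] ne.
  have ne' : (i : nat) <> j by move/val_inj => E; rewrite E eqxx in ne.
  case: (ltngtP i j) => // lt; first exact: H.
  have [|s ws [us sg rs]] := H _ _ lt; first by rewrite eq_sym.
  exists (rev s); first exact: walk_rev.
  split; rewrite ?rev_uniq ?size_rev // 1?cdist_sym //.
  by move=> v; rewrite mem_rev => /sg.
have sub a n : {subset seg g a n <= seg g 0 r}.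
  by move=> v /segP[m _ ->]; apply: mem_seg_full.
have ij' := ltn_ord j; case: (leqP (r - (j - i)) (j - i)) => le.
  exists (seg g i (j - i).+1).
    by have := walk_seg gt i (j - i); rewrite subnKC // ltnW.
  split; [apply: (uniq_seg gt); lia|exact: sub|rewrite size_seg /cdist; case: ifP; lia].
exists (rev (seg g j (r - (j - i)).+1)).
  apply: walk_rev; have := walk_seg gt j (r - (j - i)).
  have -> : j + (r - (j - i)) = i + r by lia.
  by case: gt => _ _ -> _.
split; [rewrite rev_uniq; apply: (uniq_seg gt); lia| |rewrite size_rev size_seg /cdist; case: ifP; lia].
by move=> v; rewrite mem_rev => /sub.
Qed.

Hypothesis gA : forall i, A (g i).
Hypothesis gmax : forall s : seq G, 1 < size s -> uniq s -> cycle adj s -> all A s -> size s <= r.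

Lemma ear_cdist (i j : 'I_r) s : i != j -> walk (g i) (g j) (g i :: rcons s (g j)) ->
  uniq s -> off g s -> all A s -> size s < cdist r i j.
Proof.
wlog ij : i j s / i < j => [H|] ne.
  have ne' : (i : nat) <> j by move/val_inj => E; rewrite E eqxx in ne.
  case: (ltngtP i j) => // lt ws us os As; first exact: H.
  rewrite -(size_rev s) cdist_sym; apply: H => //; rewrite ?rev_uniq ?all_rev //.
  - by rewrite eq_sym.
  - by have := walk_rev ws; rewrite rev_cons rev_rcons rcons_cons.
  - exact: off_rev.
case: s => [|x s] ws us os As; first by have [] := cdist_bound ne.
have ij' := ltn_ord j; have ji : i + (j - i) = j by lia.
have dr : 0 < j - i < r by lia.
have [w1 ix yj] : [/\ walk x (last x s) (x :: s), adj (g i) x & adj (last x s) (g j)].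
  move: ws => /=; rewrite rcons_path last_rcons !eqxx /= andbT => /and3P[-> p a].
  by rewrite p.
have := @ear_sym G A g r gt gA gmax i (j - i) x (last x s) (x :: s) dr w1 us os As ix.
by rewrite ji => /(_ yj) [l1 l2]; move: l1 l2; rewrite /cdist; clear -ij ij'; case: ifP; lia.
Qed.

End TraversalDistance.

(* Elements at heights above positions of a cycle of length r that are pairwise
   far apart: each occupies two positions of its own, one on either side. *)
Lemma half_bound (T : finType) (r : nat) (N : {set T}) (pos : T -> 'I_r) (ht : T -> nat) :
  (forall v w, v \in N -> w \in N -> pos v = pos w -> ht v = ht w -> v = w) ->
  (forall v w, v \in N -> w \in N -> pos v != pos w ->
     ht v + ht w + 2 <= cdist r (pos v) (pos w)) ->
  (forall v, v \in N -> 2 * ht v + 2 <= r) -> 2 * #|N| <= r.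
Proof.
move=> inj far low.
(* The two positions are the ends of the interval from a - h to a + h + 1. Over one base these
   intervals are nested with distinct ends, over different bases they are disjoint, and 2h + 2 <= r
   keeps them from wrapping onto themselves. *)
pose up (a h : nat) := if a + h.+1 < r then a + h.+1 else a + h.+1 - r.
pose dn (a h : nat) := if h <= a then a - h else a + r - h.
pose F (e : bool * T) := if e.1 then up (pos e.2) (ht e.2) else dn (pos e.2) (ht e.2).
have -> : 2 * #|N| = #|setX [set: bool] N| by rewrite cardsX cardsT card_bool.
apply: (@card_le_inj _ _ F).
  move=> -[b v]; rewrite !inE /= => vN; have := low _ vN; have := ltn_ord (pos v).
  by rewrite /F /up /dn /=; clear; case: b; case: ifP; lia.
have key b b' v w : v \in N -> w \in N -> F (b, v) = F (b', w) -> pos v = pos w /\ ht v = ht w /\ b = b'.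
  move=> vN wN; have lv := low _ vN; have lw := low _ wN.
  have pv := ltn_ord (pos v); have pw := ltn_ord (pos w).
  case: (eqVneq (pos v) (pos w)) => [E|ne].
    rewrite /F /up /dn /= E; move: lv lw pw; move: (ht v) (ht w) (val (pos w)) => h h' p; clear.
    by case: b; case: b'; do 2!case: ifP; split=> //; lia.
  have := far _ _ vN wN ne; rewrite /F /up /dn /cdist /=.
  move: lv lw pv pw; move: (ht v) (ht w) (val (pos v)) (val (pos w)) => h h' p p'; clear.
  by case: b; case: b'; do 3!case: ifP; lia.
move=> -[b v] [b' w]; rewrite !inE /= => vN wN /key[] // E1 [E2 E3].
by rewrite E3 (inj _ _ vN wN E1 E2).
Qed.

Section Extensions.
Variables (G : sgraph) (C : {set G}) (g : nat -> G) (r k : nat).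
Local Notation adj := (@adj G).
Hypothesis gt : traversal g r.
Hypothesis gC : forall i, g i \notin C.
Hypothesis res : resists G k.
Hypothesis kr : k <= r.
Hypothesis kC : k <= #|C|.
Implicit Types (i j : 'I_r) (v w z : G) (Q : 'I_r -> seq G).

Let D := [set v in seg g 0 r].

Definition spare v := (v \notin C) && (v \notin [set v in seg g 0 r]).

Let gD i : g i \in D.
Proof. by rewrite inE mem_seg_full. Qed.

Let Dg v : v \in D -> exists i : 'I_r, v = g i.
Proof. by rewrite inE => /segP[i /andP[_ ir] ->]; exists (Ordinal ir). Qed.

Let g_inj i j : g i = g j -> i = j.
Proof. by move=> E; apply: val_inj; case: gt => _ _ _ gi; exact: gi (ltn_ord i) (ltn_ord j) E. Qed.

Let cardD : #|D| = r.
Proof.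
have := uniq_seg gt 0 (leqnn r); move/card_uniqP; rewrite size_seg => cE.
by rewrite -[RHS]cE; apply: eq_card => z; rewrite inE.
Qed.

(* Q i omits the vertex g i at which it starts. *)
Definition extension Q :=
  [/\ forall i, path adj (g i) (Q i), forall i, all spare (Q i),
      forall i, uniq (Q i) & forall i j v, v \in Q i -> v \in Q j -> i = j].

Definition proper_ext Q := [set i | Q i != [::]].

(** The room for k disjoint connections: a proper path counts as one, a trivial position only with a
    private neighbour on C. Nothing is required of the far ends of proper paths, so lengthening them
    preserves the condition. *)
Definition well_attached Q := exists (X : {set 'I_r}) (mu : 'I_r -> G),
  [/\ forall i, i \in X -> [/\ Q i = [::], mu i \in C & adj (g i) (mu i)],
      {in X &, injective mu} & k <= #|proper_ext Q| + #|X|].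

Lemma sum_size_extension Q : extension Q -> \sum_i size (Q i) + r + #|C| <= gorder G.
Proof.
move=> [_ fQ uQ dQ].
have DC : [disjoint C & D].
  rewrite -setI_eq0; apply/eqP/setP => v; rewrite in_set0 in_setI; apply/negbTE/negP => /andP[vC /Dg[i E]].
  by have := gC i; rewrite -E vC.
have cCD : #|C :|: D| = #|C| + r by move: DC; rewrite -(leq_card_setU _ _).2 => /eqP->; rewrite cardD.
have : \sum_i size (Q i) <= #|~: (C :|: D)|.
  have -> : \sum_i size (Q i) = \sum_i \sum_(v : G) (v \in Q i).
    apply: eq_bigr => i _; move/card_uniqP: (uQ i) => <-.
    by rewrite -sum1_card big_mkcond /=; apply: eq_bigr => v _; case: (v \in Q i).
  rewrite exchange_big /= -sum1_card [X in _ <= X]big_mkcond /=; apply: leq_sum => v _.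
  have -> : (v \in ~: (C :|: D)) = spare v by rewrite in_setC in_setU negb_or.
  case: (pickP (fun i => v \in Q i)) => [i vi|no].
    rewrite (allP (fQ i) _ vi) (bigD1 i) //= vi big1 // => j ji.
    by case: (boolP (v \in Q j)) => // vj; move: ji; rewrite (dQ _ _ _ vj vi) eqxx.
  by rewrite big1 // => i _; rewrite no.
have := cardsC (C :|: D); rewrite -/(gorder G) cCD.
by move: (\sum_i _) #|~: _| => a b; clear; lia.
Qed.

(** Konig's theorem between D and the rest of the graph: a partner off C becomes a path with one
    vertex, a partner on C the value of [mu]. A small cover would separate D from C. *)
Lemma attached_extension_exists : exists Q, extension Q /\ well_attached Q.
Proof.
pose E := [set e : G * G | [&& e.1 \in D, e.2 \notin D & adj e.1 e.2]].
have [M ME [Mm kM]] : exists2 M : {set G * G}, M \subset E & is_matching M /\ k <= #|M|.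
  apply: konig => A B cov; rewrite leqNgt; apply/negP => lt.
  have [u uD uA] : exists2 u, u \in D & u \notin A.
    apply: NNPP => N; have : #|D| <= #|A|.
      by apply: subset_leq_card; apply/subsetP => u uU; apply/negPn/negP => uA; apply: N; exists u.
    by rewrite cardD; move: lt kr; clear; lia.
  have [p pC pB] : exists2 p, p \in C & p \notin B.
    apply: NNPP => N; have : #|C| <= #|B|.
      by apply: subset_leq_card; apply/subsetP => q qC; apply/negPn/negP => qB; apply: N; exists q.
    by move: lt kC; clear; lia.
  pose S := (A :&: D) :|: (B :&: ~: D).
  have lS : #|S| < k.
    apply: leq_ltn_trans lt; apply: leq_trans (leq_card_setU _ _) _.
    by apply: leq_add; apply: subset_leq_card; apply: subsetIl.
  have pD : p \notin D by apply/negP => /Dg[i Ei]; have := gC i; rewrite -Ei pC.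
  have SE v : (v \in S) = if v \in D then v \in A else v \in B.
    by rewrite in_setU !in_setI in_setC; case: (v \in D); rewrite ?andbT ?andbF ?orbF.
  have uS : u \notin S by rewrite SE uD.
  have pS : p \notin S by rewrite SE (negbTE pD).
  pose X : pred G := fun v => (v \in D) && (v \notin A).
  suff : X p by rewrite /X (negbTE pD).
  apply: connect_stable (res lS uS pS); last by rewrite /X uD.
  move=> a b /andP[aD aA] /= /andP[/andP[ab aS] bS].
  rewrite SE in bS; rewrite /X; case: (boolP (b \in D)) bS => // bD bB.
  have : (a, b) \in E by rewrite in_set /= aD bD.
  by move/cov => /= []; rewrite ?(negbTE aA) ?(negbTE bB).
pose partner i := [pick w | (g i, w) \in M].
have partnerP i w : partner i = Some w -> (g i, w) \in M.
  by rewrite /partner; case: pickP => // w' h [<-].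
have MEP e : e \in M -> [/\ e.1 \in D, e.2 \notin D & adj e.1 e.2].
  by move/(subsetP ME); rewrite in_set => /and3P.
pose Q i := if partner i is Some w then (if w \in C then [::] else [:: w]) else [::].
pose X := [set i | if partner i is Some w then w \in C else false].
pose mu i := odflt (g i) (partner i).
have Qin i v : v \in Q i -> [/\ partner i = Some v, v \notin C & Q i = [:: v]].
  by rewrite /Q; case: (partner i) => [w|] //; case: ifP => // wC; rewrite inE => /eqP->; rewrite wC.
exists Q; split.
  split.
  - move=> i; rewrite /Q; case Ei: (partner i) => [w|] //; case: ifP => //= _.
    by have [_ _ /= ->] := MEP _ (partnerP _ _ Ei).
  - move=> i; apply/allP => v /Qin[Ei vC _]; rewrite /spare vC /=.
    by have [] := MEP _ (partnerP _ _ Ei).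
  - by move=> i; rewrite /Q; case: (partner i) => [w|] //; case: ifP.
  - move=> i j v /Qin[Ei _ _] /Qin[Ej _ _]; apply: g_inj.
    by have [] := Mm _ _ (partnerP _ _ Ei) (partnerP _ _ Ej) (or_intror erefl).
exists X, mu; split.
- move=> i; rewrite in_set /Q /mu; case Ei: (partner i) => [w|] // wC; rewrite wC /=; split=> //.
  by have [_ _] := MEP _ (partnerP _ _ Ei).
- move=> i j; rewrite !in_set /mu; case Ei: (partner i) => [w|] //; case Ej: (partner j) => [w'|] //= _ _ E'.
  apply: g_inj; rewrite -E' in Ej.
  by have [] := Mm _ _ (partnerP _ _ Ei) (partnerP _ _ Ej) (or_intror erefl).
apply: leq_trans kM _; apply: leq_trans (leq_card_setU _ _).
have sub : M \subset (fun i => (g i, mu i)) @: (proper_ext Q :|: X).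
  apply/subsetP => -[a b] abM; have [/= /Dg[i Ei] _ _] := MEP _ abM; subst a.
  have [w Ew] : exists w, partner i = Some w.
    rewrite /partner; case: pickP => [w _|no]; first by exists w.
    by have := no b; rewrite abM.
  have [Eb] := Mm _ _ abM (partnerP _ _ Ew) (or_introl erefl); subst b.
  apply/imsetP; exists i; last by rewrite /mu Ew.
  by rewrite in_setU !in_set /Q Ew; case: ifP.
exact: leq_trans (subset_leq_card sub) (leq_imset_card _ _).
Qed.

(** A lexicographic order, number of proper paths before total length; the factor works because the
    total length is at most the order of the graph. *)
Definition potential Q := #|proper_ext Q| * (gorder G).+1 + \sum_i size (Q i).

Definition update Q i s := fun j => if j == i then s else Q j.

Lemma update_same Q i s : update Q i s i = s.
Proof. by rewrite /update eqxx. Qed.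

Lemma update_other Q i j s : j != i -> update Q i s j = Q j.
Proof. by rewrite /update => /negbTE->. Qed.

Lemma maximal_extension : exists Q, [/\ extension Q, well_attached Q,
  forall i z, Q i = [::] -> spare z -> adj (g i) z -> exists j s, Q j = z :: s &
  forall i z, Q i != [::] -> spare z -> adj (last (g i) (Q i)) z -> exists j, z \in Q j].
Proof.
have [n [Q [eQ wQ] Qn] nmax] : exists2 n, (exists2 Q, extension Q /\ well_attached Q & potential Q = n) &
    forall m, (exists2 Q, extension Q /\ well_attached Q & potential Q = m) -> m <= n.
  apply: (@exists_maxP _ (r * (gorder G).+1 + gorder G)).
    by have [Q HQ] := attached_extension_exists; exists (potential Q); exists Q.
  move=> m [Q [eQ _] <-]; apply: leq_add.
    by rewrite leq_mul2r -[X in _ <= X]card_ord max_card orbT.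
  by have := sum_size_extension eQ; clear; lia.
have QG := sum_size_extension eQ.
have max Q' : extension Q' -> well_attached Q' -> potential Q' <= potential Q.
  by move=> e w; rewrite Qn; apply: nmax; exists Q'.
(* Position [i] may leave [X] but becomes proper, so the count in [well_attached] survives while the
   leading term of the potential rises. *)
have more Q' i : extension Q' -> Q i = [::] -> Q' i != [::] ->
    (forall j, Q j != [::] -> Q' j != [::]) -> (forall j, j != i -> Q j = [::] -> Q' j = [::]) -> False.
  move=> eQ' Qi Q'i up dn.
  have cW : #|proper_ext Q| < #|proper_ext Q'|.
    apply: proper_card; apply/properP; split; first by apply/subsetP => j; rewrite !in_set; apply: up.
    by exists i; rewrite in_set ?Qi.
  have wQ' : well_attached Q'.
    have [X [mu [HX iX kX]]] := wQ; exists (X :\ i), mu; split.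
    - by move=> j; rewrite !in_setD1 => /andP[ji /HX[Qj mC a]]; split=> //; apply: dn.
    - by move=> a b; rewrite !in_setD1 => /andP[_ aX] /andP[_ bX]; apply: iX.
    - have le : #|X| <= #|X :\ i|.+1 by rewrite (cardsD1 i X) -add1n leq_add2r leq_b1.
      apply: leq_trans kX _; apply: leq_trans (leq_add (leqnn _) le) _.
      by rewrite addnS -addSn leq_add2r.
  have := max _ eQ' wQ'; rewrite /potential leqNgt => /negP; apply.
  have : #|proper_ext Q|.+1 * (gorder G).+1 <= #|proper_ext Q'| * (gorder G).+1.
    by rewrite leq_mul2r cW orbT.
  by rewrite mulSn; move: QG; move: (\sum_i _) (\sum_i _) (_ * _) (_ * _) => a b x y; clear; lia.
case: (eQ) => pQ fQ uQ dQ.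
exists Q; split=> // i z Qi fz az.
- apply: NNPP => N; case: (pickP (fun j => z \in Q j)) => [j zj|no].
    have ji : j != i by apply/eqP => E; rewrite E Qi in zj.
    have ij : i != j by rewrite eq_sym.
    have [s1 [s2 Qj]] : exists s1 s2, Q j = s1 ++ z :: s2.
      by case/splitPr: zj => s1 s2; exists s1, s2.
    case: s1 Qj => [|a s1] Qj; first by apply: N; exists j, s2.
    (* The tail from [z] on moves to [i]. Since [z] is not the first vertex of [Q j], the path at
       [j] remains proper. *)
    pose Q' := update (update Q j (a :: s1)) i (z :: s2).
    have Q'i : Q' i = z :: s2 by rewrite /Q' update_same.
    have Q'j : Q' j = a :: s1 by rewrite /Q' update_other // update_same.
    have Q'o l : l != i -> l != j -> Q' l = Q l by move=> li lj; rewrite /Q' !update_other.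
    have pj := pQ j; have fj := fQ j; have uj := uQ j; rewrite Qj in pj fj uj.
    have Q'1 v : v \in Q' i -> v \in Q j.
      by rewrite Q'i Qj !mem_cat => ->; rewrite orbT.
    have Q'2 v : v \in Q' j -> v \in Q j by rewrite Q'j Qj mem_cat => ->.
    have Q'12 v : v \in Q' i -> v \in Q' j -> False.
      rewrite Q'i Q'j => vi vj; move: uj; rewrite cat_uniq => /and3P[_ /hasPn/(_ v vi)].
      by rewrite /= vj.
    apply: (@more Q' i) => //.
    + split.
      * move=> l; case: (eqVneq l i) => [->|li].
          by rewrite Q'i /= az; move: pj; rewrite cat_path => /andP[_] /= /andP[].
        case: (eqVneq l j) => [->|lj]; last by rewrite Q'o.
        by rewrite Q'j; move: pj; rewrite cat_path => /andP[].
      * move=> l; case: (eqVneq l i) => [->|li].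
          by rewrite Q'i; move: fj; rewrite all_cat => /andP[].
        case: (eqVneq l j) => [->|lj]; last by rewrite Q'o.
        by rewrite Q'j; move: fj; rewrite all_cat => /andP[].
      * move=> l; case: (eqVneq l i) => [->|li].
          by rewrite Q'i; move: uj; rewrite cat_uniq => /and3P[].
        case: (eqVneq l j) => [->|lj]; last by rewrite Q'o.
        by rewrite Q'j; move: uj; rewrite cat_uniq => /and3P[].
      * have src l v : v \in Q' l -> exists2 l', v \in Q l' & l' = (if l == i then j else l).
          case: (eqVneq l i) => [->|li]; first by move/Q'1; exists j.
          case: (eqVneq l j) => [->|lj]; first by move/Q'2; exists j.
          by rewrite Q'o // => vl; exists l.
        move=> l l' v vl vl'; have [m vm Em] := src _ _ vl; have [m' vm' Em'] := src _ _ vl'.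
        have := dQ _ _ _ vm vm'; rewrite Em Em'.
        case: (eqVneq l i) => [El|li]; case: (eqVneq l' i) => [El'|li'].
        -- by rewrite El El'.
        -- by move=> E; subst l l'; case: (Q'12 v).
        -- by move=> E; subst l l'; case: (Q'12 v).
        -- by [].
    + by rewrite Q'i.
    + move=> l Ql; case: (eqVneq l i) => [->|li]; first by rewrite Q'i.
      by case: (eqVneq l j) => [->|lj]; rewrite ?Q'j ?Q'o.
    + move=> l li Ql; case: (eqVneq l j) => [El|lj]; last by rewrite Q'o.
      by move: Ql; rewrite El Qj.
  pose Q' := update Q i [:: z].
  have Q'i : Q' i = [:: z] by rewrite /Q' update_same.
  have Q'o l : l != i -> Q' l = Q l by move=> li; rewrite /Q' update_other.
  apply: (@more Q' i) => //; first split.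
  + move=> l; case: (eqVneq l i) => [->|li]; last by rewrite Q'o.
    by rewrite Q'i /= az.
  + move=> l; case: (eqVneq l i) => [->|li]; last by rewrite Q'o.
    by rewrite Q'i /= fz.
  + by move=> l; case: (eqVneq l i) => [->|li]; [rewrite Q'i|rewrite Q'o].
  + move=> l l' v; case: (eqVneq l i) => [->|li]; case: (eqVneq l' i) => [->|li'] //.
    * by rewrite Q'i (Q'o l') // inE => /eqP->; rewrite no.
    * by rewrite Q'i (Q'o l) // inE => vl /eqP E; move: vl; rewrite E no.
    * by rewrite !Q'o //; apply: dQ.
  + by rewrite Q'i.
  + by move=> l Ql; case: (eqVneq l i) => [->|li]; rewrite ?Q'i ?Q'o.
  + by move=> l li Ql; rewrite Q'o.
apply: NNPP => N.
have no j : z \notin Q j by apply/negP => zj; apply: N; exists j.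
pose Q' := update Q i (rcons (Q i) z).
have Q'i : Q' i = rcons (Q i) z by rewrite /Q' update_same.
have Q'o l : l != i -> Q' l = Q l by move=> li; rewrite /Q' update_other.
have Q'n l : (Q' l != [::]) = (Q l != [::]).
  case: (eqVneq l i) => [->|li]; last by rewrite Q'o.
  by rewrite Q'i Qi; case: (Q i).
have eQ' : extension Q'.
  split.
  - move=> l; case: (eqVneq l i) => [->|li]; last by rewrite Q'o.
    by rewrite Q'i rcons_path pQ az.
  - move=> l; case: (eqVneq l i) => [->|li]; last by rewrite Q'o.
    by rewrite Q'i all_rcons fz fQ.
  - move=> l; case: (eqVneq l i) => [->|li]; last by rewrite Q'o.
    by rewrite Q'i rcons_uniq no uQ.
  - move=> l l' v; case: (eqVneq l i) => [->|li]; case: (eqVneq l' i) => [->|li'] //.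
    + rewrite Q'i (Q'o l') // mem_rcons inE => /orP[/eqP->|]; first by rewrite (negbTE (no l')).
      exact: dQ.
    + rewrite Q'i (Q'o l) // mem_rcons inE => vl /orP[/eqP E|]; first by move: vl; rewrite E (negbTE (no l)).
      exact: dQ.
    + by rewrite !Q'o //; apply: dQ.
have pE : proper_ext Q' = proper_ext Q by apply/setP => l; rewrite !in_set Q'n.
have wQ' : well_attached Q'.
  have [X [mu [HX iX kX]]] := wQ; exists X, mu; split; rewrite ?pE //.
  move=> j jX; have [Qj ? ?] := HX _ jX; split=> //; apply/eqP/negPn.
  by rewrite Q'n Qj.
have := max _ eQ' wQ'; rewrite /potential pE leq_add2l leqNgt => /negP; apply.
rewrite (bigD1 i) //= [X in _ < X](bigD1 i) //= Q'i size_rcons addSn ltnS leq_add2l.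
by apply: leq_sum => l li; rewrite Q'o.
Qed.

End Extensions.

Section Ends.
Variables (G : sgraph) (C : {set G}) (g : nat -> G) (r : nat) (Q : 'I_r -> seq G).
Local Notation adj := (@adj G).
Hypothesis gt : traversal g r.
Hypothesis gC : forall i, g i \notin C.
Hypothesis gmax : forall s : seq G, 1 < size s -> uniq s -> cycle adj s ->
  all (fun v => v \notin C) s -> size s <= r.
Hypothesis eQ : extension C g Q.
Hypothesis trivial_closed : forall i z, Q i = [::] -> spare C g r z -> adj (g i) z ->
  exists j s, Q j = z :: s.
Hypothesis proper_closed : forall i z, Q i != [::] -> spare C g r z ->
  adj (last (g i) (Q i)) z -> exists j, z \in Q j.
Implicit Types (i j : 'I_r) (v w z : G).

Definition tip i := last (g i) (Q i).

Definition codeg i := #|[set z | adj (tip i) z && (z \notin C)]|.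

Definition foot i := head (g i) (Q i).

Let spareP i v : v \in Q i -> spare C g r v.
Proof. by case: eQ => _ fQ _ _; apply: (allP (fQ i)). Qed.

Let spare_notC v : spare C g r v -> v \notin C. Proof. by case/andP. Qed.

Let spare_notg v : spare C g r v -> forall n, g n != v.
Proof.
move=> /andP[_ vD] n; move: vD; apply: contraNneq => <-; by rewrite inE mem_seg_full.
Qed.

Let g_inj i j : g i = g j -> i = j.
Proof. by move=> E; apply: val_inj; case: gt => _ _ _ gi; exact: gi (ltn_ord i) (ltn_ord j) E. Qed.

Let base_uniq i : uniq (g i :: Q i).
Proof.
case: (eQ) => _ _ uQ _; rewrite /= uQ andbT; apply/negP => /spareP/spare_notg/(_ i).
by rewrite eqxx.
Qed.

Let base_notC i v : v \in g i :: Q i -> v \notin C.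
Proof. by rewrite inE => /orP[/eqP->//|/spareP/spare_notC]. Qed.

Let base_walk i : walk (g i) (tip i) (g i :: Q i).
Proof. by case: (eQ) => pQ _ _ _; apply: walk_path. Qed.

Lemma tip_notC i : tip i \notin C.
Proof. by apply: base_notC; apply: mem_last. Qed.

Lemma tip_proper i : Q i != [::] -> tip i \in Q i.
Proof. by rewrite /tip; case: (Q i) => //= a s _; apply: mem_last. Qed.

(** Down [Q i], along the longer arc of the cycle, up [Q j]. *)
Lemma tip_walk i j : i != j -> exists2 s, walk (tip i) (tip j) s &
  [/\ uniq s, forall v, v \in s -> v \notin C & r < size s + cdist r i j].
Proof.
move=> ij; have [s ws [us sg rs]] := long_arc gt ij.
have [s' Es] : exists s', s = g i :: s'.
  by case: s ws {us sg rs} => // a s' /= /and3P[/eqP-> _ _]; exists s'.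
have sg' v : v \in s' -> exists n, v = g n.
  by move=> vs; have /sg /segP[n _ ->] : v \in s; [rewrite Es inE vs orbT|exists n].
have w1 := walk_glue (walk_rev (base_walk i)) ws.
have w2 := walk_glue w1 (base_walk j); rewrite /= Es /= -catA in w2.
have us' : uniq s' by move: us; rewrite Es => /= /andP[].
have [ui uj] := (base_uniq i, base_uniq j).
exists (rev (g i :: Q i) ++ s' ++ Q j) => //; split.
- apply: uniq_cat3; rewrite ?rev_uniq //; first by case/andP: uj.
  + move=> v; rewrite mem_rev inE => /orP[/eqP->|vi].
      by move: us; rewrite Es => /= /andP[].
    by apply/negP => /sg'[n E]; move/spareP/spare_notg: vi => /(_ n); rewrite E eqxx.
  + move=> v; rewrite mem_rev inE => /orP[/eqP->|vi]; apply/negP => vj.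
      by move/spareP/spare_notg: vj => /(_ i); rewrite eqxx.
    by case: eQ => _ _ _ /(_ i j v vi vj) E; rewrite E eqxx in ij.
  + by move=> v /sg'[n E]; apply/negP => /spareP/spare_notg/(_ n); rewrite E eqxx.
- move=> v; rewrite !mem_cat mem_rev => /or3P[/base_notC//|/sg'[n ->]//|/spareP/spare_notC//].
- by move: rs; rewrite Es !size_cat size_rev /=; clear; lia.
Qed.

Let prefix_walk j z : z \in g j :: Q j ->
  walk (g j) z (g j :: take (index z (g j :: Q j)) (Q j)).
Proof.
move=> zj; have := base_walk j; have lt : index z (g j :: Q j) < size (g j :: Q j) by rewrite index_mem.
rewrite -{1}(cat_take_drop (index z (g j :: Q j)) (g j :: Q j)) drop_index // => /walk_cat_inv[+ _].
have -> : rcons (take (index z (g j :: Q j)) (g j :: Q j)) z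
  = take (index z (g j :: Q j)).+1 (g j :: Q j) by rewrite (take_nth z lt) nth_index.
by [].
Qed.

Let suffix_walk j z : z \in g j :: Q j ->
  walk z (tip j) (drop (index z (g j :: Q j)) (g j :: Q j)).
Proof.
move=> zj; have := base_walk j.
by rewrite -{1}(cat_take_drop (index z (g j :: Q j)) (g j :: Q j)) drop_index // => /walk_cat_inv[].
Qed.

Let earQ i j s : i != j -> walk (g i) (g j) (g i :: rcons s (g j)) -> uniq s ->
  (forall v, v \in s -> spare C g r v) -> size s < cdist r i j.
Proof.
move=> ij ws us fs; apply: (@ear_cdist G (fun v => v \notin C) g r) ws us _ _ => //.
  by move=> n; apply/negP => /fs/spare_notg/(_ n); rewrite eqxx.
by apply/allP => v /fs/spare_notC.
Qed.

Let take_spare j h v : v \in take h (Q j) -> spare C g r v.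
Proof. by move/mem_take/spareP. Qed.

Let cross1 i j z : i != j -> z \in g j :: Q j -> adj (tip i) z ->
  size (Q i) + index z (g j :: Q j) < cdist r i j.
Proof.
move=> ij zj az; have lt : index z (g j :: Q j) <= size (Q j) by rewrite -ltnS -[(size _).+1]/(size (g j :: Q j)) index_mem.
have w := walk_cat (base_walk i) (walk_rev (prefix_walk zj)) az.
rewrite rev_cons -rcons_cat cat_cons rcons_cons in w.
case: (eQ) => _ _ uQ dQ.
have := earQ ij w; rewrite size_cat size_rev size_takel //.
apply.
  apply: uniq_cat2; rewrite ?rev_uniq ?take_uniq // => v vi; rewrite mem_rev; apply/negP => /mem_take vj.
  by rewrite (dQ _ _ _ vi vj) eqxx in ij.
by move=> v; rewrite mem_cat mem_rev => /orP[/spareP|/take_spare].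
Qed.

Let cross2 i j j' z z' : Q i != [::] -> i != j -> i != j' -> j != j' ->
  z \in g j :: Q j -> z' \in g j' :: Q j' -> adj (tip i) z -> adj (tip i) z' ->
  index z (g j :: Q j) + index z' (g j' :: Q j') + 2 <= cdist r j j'.
Proof.
move=> Qi ij ij' jj' zj zj' az az'.
have lt : index z (g j :: Q j) <= size (Q j) by rewrite -ltnS -[(size _).+1]/(size (g j :: Q j)) index_mem.
have lt' : index z' (g j' :: Q j') <= size (Q j') by rewrite -ltnS -[(size _).+1]/(size (g j' :: Q j')) index_mem.
rewrite adj_sym in az.
have w := walk_cat (prefix_walk zj) (walk_cat (walk1 (tip i)) (walk_rev (prefix_walk zj')) az') az.
rewrite rev_cons -!rcons_cat cat_cons rcons_cons in w.
case: (eQ) => _ _ uQ dQ; have ti := tip_proper Qi.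
have := earQ jj' w; rewrite size_cat size_takel // -[size (_ :: _)]/(size _).+1 size_rev size_takel //.
move=> H; suff : index z (g j :: Q j) + (index z' (g j' :: Q j')).+1 < cdist r j j' by clear; lia.
apply: H.
  have := @uniq_cat3 G (take (index z (g j :: Q j)) (Q j)) [:: tip i] (rev (take (index z' (g j' :: Q j')) (Q j'))).
  rewrite /=; apply; rewrite ?rev_uniq ?take_uniq //.
  - move=> v /mem_take vj; rewrite inE; apply/eqP => E; rewrite E in vj.
    by rewrite (dQ _ _ _ ti vj) eqxx in ij.
  - move=> v /mem_take vj; rewrite mem_rev; apply/negP => /mem_take vj'.
    by rewrite (dQ _ _ _ vj vj') eqxx in jj'.
  - move=> v; rewrite inE => /eqP->; rewrite mem_rev; apply/negP => /mem_take vj'.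
    by rewrite (dQ _ _ _ ti vj') eqxx in ij'.
move=> v; rewrite mem_cat inE mem_rev => /or3P[/take_spare//|/eqP->|/take_spare//]; exact: spareP ti.
Qed.

(** If the tip has a neighbour on another path or its base, then all its neighbours, located by base
    position and height, are far apart around the cycle, since shortcuts through the tip are ears;
    [half_bound] applies. Otherwise they lie on its own path or at [g i], and the lowest one closes
    a cycle off C with the tip. *)
Lemma codeg_proper i : Q i != [::] ->
  2 * codeg i <= r \/ (codeg i <= size (Q i) /\ codeg i < r).
Proof.
move=> Qi; have r1 := trav_gt1 gt.
pose N := [set z | adj (tip i) z && (z \notin C)].
(* The default is never taken on [N]: by [proper_closed] each neighbour off C lies on the cycle or
   on some path. *)
pose pos (z : G) := odflt i [pick j : 'I_r | z \in g j :: Q j].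
pose ht (z : G) := index z (g (pos z) :: Q (pos z)).
have inpos z : z \in N -> z \in g (pos z) :: Q (pos z).
  rewrite in_set => /andP[az zC]; rewrite /pos; case: pickP => //= no.
  case: (boolP (spare C g r z)) => fz.
    by have [j zj] := proper_closed Qi fz az; have := no j; rewrite inE zj orbT.
  move: fz; rewrite /spare zC /= negbK inE => /segP[n /andP[_ nr] E].
  by have := no (Ordinal nr); rewrite E inE eqxx.
have adjN z : z \in N -> adj (tip i) z by rewrite in_set => /andP[].
have own z : z \in N -> pos z = i -> ht z < size (Q i).
  move=> zN pz; have := inpos _ zN; rewrite /ht pz => zi.
  have lt : index z (g i :: Q i) < size (g i :: Q i) by rewrite index_mem.
  rewrite ltn_neqAle -ltnS lt andbT; apply/eqP => E.
  have : z = tip i by rewrite -(nth_index z zi) E /tip (last_nth z).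
  by move=> zt; have := adjN _ zN; rewrite zt adj_irr.
have inj v w : v \in N -> w \in N -> pos v = pos w -> ht v = ht w -> v = w.
  move=> vN wN Ep Eh; have vi := inpos _ vN; have wi := inpos _ wN.
  by rewrite -(nth_index v vi) -(nth_index v wi) -/(ht v) -/(ht w) Ep Eh.
case: (classic (exists2 z, z \in N & pos z != i)) => [[z0 z0N pz0]|all_i]; [left|right].
  have c1 z : z \in N -> pos z != i -> size (Q i) + ht z < cdist r i (pos z).
    by move=> zN pz; apply: cross1 => //; [rewrite eq_sym|exact: inpos|exact: adjN].
  have q0 : 0 < size (Q i) by case: (Q i) Qi.
  apply: (@half_bound _ _ N pos ht) => //.
    have half v w : v \in N -> w \in N -> pos v = i -> pos w != i ->
        ht v + ht w + 2 <= cdist r i (pos w).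
      by move=> vN wN pv pw; have := own _ vN pv; have := c1 _ wN pw; clear; lia.
    move=> v w vN wN vw; case: (eqVneq (pos v) i) => [pv|pv].
      by rewrite pv; apply: half => //; rewrite -pv eq_sym.
    case: (eqVneq (pos w) i) => [pw|pw].
      by rewrite pw cdist_sym (addnC (ht v)); apply: half.
    apply: (@cross2 i) => //; rewrite 1?eq_sym //; by [apply: inpos|apply: adjN].
  move=> v vN; have := c1 _ z0N pz0.
  have iz0 : i != pos z0 by rewrite eq_sym.
  have [_ b0] := cdist_bound iz0.
  case: (eqVneq (pos v) i) => [pv|pv]; first by have := own _ vN pv; move: b0; clear; lia.
  have iv : i != pos v by rewrite eq_sym.
  by have [_ bv] := cdist_bound iv; have := c1 _ vN pv; move: bv q0; clear; lia.
have pi z : z \in N -> pos z = i.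
  by move=> zN; apply/eqP/negPn/negP => pz; apply: all_i; exists z.
case: (set_0Vmem N) => [E|[z1 z1N]].
  by rewrite /codeg -/N E cards0; split=> //; move: r1; clear; lia.
case: (@arg_minnP _ z1 (mem N) ht z1N) => z0 z0N hmin.
have cN : #|N| <= size (Q i) - ht z0.
  apply: (@card_le_inj _ N (fun z => ht z - ht z0)).
    by move=> z zN; have := own _ zN (pi _ zN); have := hmin z zN; clear; lia.
  move=> v w vN wN E; apply: inj => //; first by rewrite !pi.
  by move: E (hmin v vN) (hmin w wN); clear; lia.
have z0i : z0 \in g i :: Q i by have := inpos _ z0N; rewrite pi.
have hE : index z0 (g i :: Q i) = ht z0 by rewrite /ht pi.
have w0 := suffix_walk z0i; rewrite hE in w0.
have o0 := own _ z0N (pi _ z0N).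
have : size (drop (ht z0) (g i :: Q i)) <= r.
  apply: gmax.
  - by rewrite size_drop /=; move: o0; clear; lia.
  - exact: drop_uniq.
  - exact: walk_cycle w0 (adjN _ z0N).
  - by apply/allP => v /mem_drop/base_notC.
rewrite size_drop /= /codeg -/N; move: o0 cN; clear; lia.
Qed.

(** Between two consecutive vertices of the cycle a common neighbour could be inserted, so the
    neighbours of the foot are pairwise at distance at least 2. *)
Lemma foot_nbrs j : Q j != [::] -> 2 * #|[set i : 'I_r | adj (g i) (foot j)]| <= r.
Proof.
move=> Qj; have ff : spare C g r (foot j).
  by apply: (@spareP j); rewrite /foot; case: (Q j) Qj => //= a s _; rewrite inE eqxx.
have r1 := trav_gt1 gt.
apply: (@half_bound _ _ _ id (fun=> 0)) => // i i'; rewrite !in_set => ai ai' ii'.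
rewrite !add0n; have := @earQ i i' [:: foot j] ii'; rewrite /= ai [adj (foot j) _]adj_sym ai' !eqxx /=.
by apply=> // v; rewrite inE => /eqP->.
Qed.

Lemma codeg_trivial i : Q i = [::] ->
  codeg i <= r.-1 + #|[set j : 'I_r | (Q j != [::]) && adj (g i) (foot j)]|.
Proof.
move=> Qi; have ti : tip i = g i by rewrite /tip Qi.
pose J := [set j : 'I_r | (Q j != [::]) && adj (g i) (foot j)].
pose I' := [set~ i].
have sub : [set z | adj (tip i) z && (z \notin C)] \subset
    [set g j | j : 'I_r in I'] :|: [set foot j | j in J].
  apply/subsetP => z; rewrite in_set ti => /andP[az zC]; rewrite in_setU.
  case: (boolP (spare C g r z)) => fz.
    have [j [s Ej]] := trivial_closed Qi fz az; apply/orP; right; apply/imsetP; exists j.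
      by rewrite in_set Ej /= /foot Ej.
    by rewrite /foot Ej.
  apply/orP; left; move: fz; rewrite /spare zC /= negbK inE => /segP[n /andP[_ nr] E].
  apply/imsetP; exists (Ordinal nr) => //; rewrite !inE; apply/eqP => Ei.
  by move: az; rewrite -Ei E /= adj_irr.
have cI : #|I'| = r.-1 by rewrite cardsC1 card_ord.
apply: leq_trans (subset_leq_card sub) _; apply: leq_trans (leq_card_setU _ _) _.
by apply: leq_add; rewrite -?cI; apply: leq_imset_card.
Qed.

Definition trivial_nbrs j := #|[set i : 'I_r | (Q i == [::]) && adj (g i) (foot j)]|.

(** Position [j] is a neighbour of its foot without being trivial, which saves one. *)
Lemma trivial_nbrs_bound j : Q j != [::] -> 2 * (trivial_nbrs j).+1 <= r.
Proof.
move=> Qj; apply: leq_trans (foot_nbrs Qj); rewrite leq_mul2l /=.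
apply: proper_card; apply/properP; split.
  by apply/subsetP => i; rewrite !in_set => /andP[].
exists j; rewrite !in_set ?(negbTE Qj) //.
by case: (eQ) => pQ _ _ _; have := pQ j; rewrite /foot; case: (Q j) Qj => //= a s _ /andP[].
Qed.

(** Off C a trivial tip sees at most r - 1 vertices of the cycle and otherwise only feet; each
    adjacency with a foot is charged to the path of that foot, whose length can pay for it. *)
Lemma sum_codeg : \sum_i codeg i <=
  #|[set i | Q i == [::]]| * r.-1 + \sum_(j in proper_ext Q) (trivial_nbrs j + codeg j).
Proof.
rewrite (bigID (fun i => Q i == [::])) /= [X in _ + X <= _](eq_bigl (mem (proper_ext Q))); last first.
  by move=> i; rewrite /= in_set.
rewrite big_split /= addnA leq_add2r.
have : \sum_(i | Q i == [::]) codeg i <= \sum_(i | Q i == [::])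
    (r.-1 + \sum_(j in proper_ext Q) (adj (g i) (foot j))).
  apply: leq_sum => i /eqP Qi; apply: leq_trans (codeg_trivial Qi) _; rewrite leq_add2l.
  rewrite -sum1_card [X in _ <= X]big_mkcond [X in X <= _]big_mkcond /=; apply: leq_sum => j _.
  by rewrite !in_set; case: (Q j != [::]); case: (Defs.adj _ _).
move/leq_trans; apply; rewrite big_split /= sum_nat_const exchange_big /=; apply: leq_add.
  by rewrite leq_mul2r; apply/orP; right; apply: subset_leq_card; apply/subsetP => i; rewrite in_set.
apply: leq_sum => j _; rewrite /trivial_nbrs -sum1_card [X in X <= _]big_mkcond [X in _ <= X]big_mkcond /=.
apply: leq_sum => i _; by rewrite in_set; case: (Q i == [::]); case: (Defs.adj _ _).
Qed.

End Ends.

(** * Attaching an extension system to the longest cycle *)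

Section TipsOnCycle.
Variables (G : sgraph) (C : {set G}) (g : nat -> G) (r : nat) (Q : 'I_r -> seq G).
Local Notation adj := (@adj G).
Hypothesis gt : traversal g r.
Hypothesis gC : forall i, g i \notin C.
Hypothesis eQ : extension C g Q.
Variables (f : nat -> G) (c : nat).
Hypothesis ft : traversal f c.
Hypothesis fmax : forall s : seq G, 1 < size s -> uniq s -> cycle adj s -> size s <= c.
Hypothesis Cf : forall v, (v \in C) = (v \in seg f 0 c).
Local Notation tip := (tip g Q).
Implicit Types (i j : 'I_r).

Definition attach (f : nat -> G) u := [set i : 'I_r | adj (tip i) (f u)].

Definition cdeg i := #|[set z | adj (tip i) z && (z \in C)]|.

Lemma deg_tip i : degree (tip i) = cdeg i + codeg C g Q i.
Proof.
rewrite /degree -(cardsID C) /cdeg /codeg.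
by congr (_ + _); apply: eq_card => z; rewrite !in_set // andbC.
Qed.

Let fmaxT : forall s : seq G, 1 < size s -> uniq s -> cycle adj s -> all predT s -> size s <= c.
Proof. by move=> s ? ? ? _; apply: fmax. Qed.

Let offC s : (forall v, v \in s -> v \notin C) -> off f s.
Proof. by move=> sC n; apply/negP => /sC; rewrite Cf mem_seg_full. Qed.

Lemma attach_far u v i j : u < v -> v < u + c -> i \in attach f u -> j \in attach f v ->
  i != j -> r + 2 <= v - u + cdist r i j.
Proof.
rewrite !in_set => uv vc iu jv ij.
have [s ws [us sC rs]] := tip_walk gt gC eQ ij.
have dc : 0 < v - u < c by lia.
have E : u + (v - u) = v by lia.
rewrite adj_sym in iu.
have := @ear G predT f c ft (fun=> isT) fmaxT u (v - u) _ _ s dc ws us (offC sC) (all_predT _) iu.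
by rewrite E => /(_ jv); move: rs; clear; lia.
Qed.

Lemma attach_apart u v : u < v -> v < u + c -> attach f u != set0 -> attach f v != set0 -> 2 <= v - u.
Proof.
move=> uv vc /set0Pn[i iu] /set0Pn[j jv]; case: (eqVneq i j) => [E|ij].
  subst j; move: iu jv; rewrite !in_set => iu jv.
  have dc : 0 < v - u < c by lia.
  have E : u + (v - u) = v by lia.
  rewrite adj_sym in iu.
  have sC z : z \in [:: tip i] -> z \notin C by rewrite inE => /eqP->; apply: (tip_notC gC eQ).
  have := @ear G predT f c ft (fun=> isT) fmaxT u (v - u) _ _ [:: tip i] dc (walk1 _) isT (offC sC) (all_predT _) iu.
  by rewrite E => /(_ jv).
by have := attach_far uv vc iu jv ij; have [_] := cdist_bound ij; clear; lia.
Qed.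

Lemma attach_period : attach f c = attach f 0.
Proof. by apply/setP => i; rewrite !in_set -[c]add0n; case: ft => _ _ -> _. Qed.

Lemma card_cdeg i : cdeg i = #|[set u : 'I_c | adj (tip i) (f u)]|.
Proof.
rewrite -[RHS](@card_in_imset _ _ (fun u : 'I_c => f u)); last first.
  by move=> x y _ _ E; apply: val_inj; case: ft => _ _ _ fi; exact: fi (ltn_ord x) (ltn_ord y) E.
apply: eq_card => z; rewrite !in_set Cf; apply/andP/imsetP => [[vz /segP[n nc zi]]|[u]].
  by rewrite add0n in nc; exists (Ordinal nc); rewrite ?inE -?zi.
by rewrite inE => vu ->; rewrite vu; split=> //; apply: mem_seg_full.
Qed.

Lemma sum_attach : \sum_(u < c) #|attach f u| = \sum_i cdeg i.
Proof.
transitivity (\sum_(u < c) \sum_(i : 'I_r) (adj (tip i) (f u) : nat)).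
  apply: eq_bigr => u _; rewrite -sum1_card big_mkcond /=; apply: eq_bigr => i _.
  by rewrite in_set; case: (Defs.adj _ _).
rewrite exchange_big /=; apply: eq_bigr => i _; rewrite card_cdeg -sum1_card [RHS]big_mkcond /=.
by apply: eq_bigr => u _; rewrite in_set; case: (Defs.adj _ _).
Qed.

End TipsOnCycle.

Section SmallCycle.
Variables (G : sgraph) (C : {set G}) (g : nat -> G) (r : nat) (Q : 'I_r -> seq G).
Local Notation adj := (@adj G).
Hypothesis gt : traversal g r.
Hypothesis gC : forall i, g i \notin C.
Hypothesis eQ : extension C g Q.
Variables (f : nat -> G) (c : nat).
Hypothesis ft : traversal f c.
Hypothesis fmax : forall s : seq G, 1 < size s -> uniq s -> cycle adj s -> size s <= c.
Hypothesis Cf : forall v, (v \in C) = (v \in seg f 0 c).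
Local Notation tip := (tip g Q).
Local Notation cdeg := (cdeg C g Q).
Implicit Types (i j : 'I_r).

Let r1 : 0 < r. Proof. exact: ltnW (trav_gt1 gt). Qed.

Lemma shift_seg a v : (v \in C) = (v \in seg (fun n => f (a + n)) 0 c).
Proof.
rewrite Cf; apply/idP/segP => [/segP[n _ ->]|[n _ ->]]; last exact: mem_seg_full.
have /segP[m /andP[am mc] ->] := mem_seg_full ft a n.
by exists (m - a); [lia|congr f; lia].
Qed.

Lemma cdeg_sum_bound : (exists i, 1 < cdeg i) -> r.+1 * \sum_i cdeg i <= r * c.
Proof.
move=> [i ci]; rewrite (card_cdeg g Q ft Cf) in ci.
have /card_gt1P[u [v [+ + uv]]] := ci; rewrite !in_set => iu iv.
wlog {uv} uv : u v iu iv / u < v.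
  move=> H; have ne : (u : nat) <> v by move/val_inj => E; rewrite E eqxx in uv.
  by case: (ltngtP u v) => // lt; [apply: (H u v)|apply: (H v u)].
(* [attached_sum] wants position 0 and one more position to be attached; the two neighbours of the
   tip [i] provide them. *)
pose f' n := f (u + n).
have ft' : traversal f' c := trav_shift ft u.
have Cf' := shift_seg u.
rewrite -(sum_attach g Q ft' Cf').
apply: attached_sum => //.
- exact: attach_period.
- exact: (attach_far gt gC eQ ft' fmax Cf').
- exact: (attach_apart gt gC eQ ft' fmax Cf').
- by apply/set0Pn; exists i; rewrite in_set /f' addn0.
exists (v - u); first by have := ltn_ord v; lia.
by apply/set0Pn; exists i; rewrite in_set /f' subnKC // ltnW.
Qed.

Definition representatives (X : {set 'I_r}) (nu : 'I_r -> G) :=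
  (forall i, i \in X -> nu i \in C /\ adj (tip i) (nu i)) /\ {in X &, injective nu}.

Lemma representatives_extend X nu i : representatives X nu -> i \notin X -> #|X| < cdeg i ->
  exists nu', representatives (i |: X) nu'.
Proof.
move=> [HX inj] iX lt.
have [z zi zX] : exists2 z, (z \in C) && adj (tip i) z & z \notin nu @: X.
  apply: NNPP => N; move: lt; rewrite ltnNge => /negP; apply.
  apply: leq_trans (leq_imset_card nu X); apply: subset_leq_card; apply/subsetP => z.
  by rewrite in_set => zi; apply/negPn/negP => zX; apply: N; exists z => //; rewrite andbC.
exists (fun j => if j == i then z else nu j); split.
  by move=> j; rewrite in_setU1; case: eqP => [-> _|_ /HX//]; case/andP: zi.
move=> a b; rewrite !in_setU1; case: (eqVneq a i) => [->|ai]; case: (eqVneq b i) => [->|bi] //=.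
- by move=> _ bX E; move: zX; rewrite E imset_f.
- by move=> aX _ E; move: zX; rewrite -E imset_f.
exact: inj.
Qed.

Lemma cdeg_sum_bonus X nu : representatives X nu -> 1 < #|X| ->
  r.+1 * (\sum_i cdeg i + r * #|X|) <= 2 * r * c.
Proof.
move=> [HX inj] /card_gt1P[x0 [x1 [x0X x1X x01]]].
have [C0 a0] := HX _ x0X; have [C1 a1] := HX _ x1X.
have [u0 _ E0] : exists2 u, 0 <= u < c & nu x0 = f u by move: C0; rewrite Cf => /segP.
pose f' n := f (u0 + n).
have ft' : traversal f' c := trav_shift ft u0.
have Cf' := shift_seg u0; rewrite -/f' in Cf'.
(* By [inj] the pick is forced. The rotation puts the representative of [x0] at 0, and [x1] yields
   the second one that [e_more] asks for. *)
pose e n := [pick i | (i \in X) && (nu i == f' n)].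
have eP n i : e n = Some i -> i \in X /\ nu i = f' n.
  by rewrite /e; case: pickP => // j /andP[jX /eqP E] [<-].
have eS n i : i \in X -> nu i = f' n -> e n = Some i.
  move=> iX E; rewrite /e; case: pickP => [j /andP[jX /eqP Ej]|/(_ i)]; last by rewrite iX E eqxx.
  by congr Some; apply: inj => //; rewrite Ej E.
have f'0 : f' 0 = nu x0 by rewrite /f' addn0.
have f'c : f' c = f' 0 by rewrite -[c]add0n; case: ft' => _ _ -> _.
have [u1 u1c E1] : exists2 u, 0 <= u < c & nu x1 = f' u by move: C1; rewrite Cf' => /segP.
have u10 : 0 < u1.
  by rewrite lt0n; apply/eqP => E; move: x01; rewrite (inj x0 x1) ?eqxx // E1 E f'0.
have bonus : r.+1 * (\sum_(u < c) #|attach g Q f' u| + r * chosen e c) <= 2 * r * c.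
  apply: (@attached_sum_bonus r c (attach g Q f') r1 _ _ _ e _ _ x0).
  - exact: attach_period.
  - exact: (attach_far gt gC eQ ft' fmax Cf').
  - exact: (attach_apart gt gC eQ ft' fmax Cf').
  - by move=> n i /eP[/HX[_ ai] E]; rewrite in_set -E.
  - move=> u v x uv vc /eP[_ Eu] /eP[_ Ev].
    have := trav_inj ft' (etrans (esym Eu) Ev); case: (ltngtP v c) vc => // [vc _|vE _].
      by rewrite !modn_small ?(ltn_trans uv vc) // => E; rewrite E ltnn in uv.
    by rewrite vE in uv *; rewrite modnn modn_small // => ->.
  - by apply: eS.
  - by apply: eS; rewrite ?f'c.
  - by exists u1; [rewrite u10; case/andP: u1c|rewrite (eS _ x1)].
rewrite (sum_attach g Q ft' Cf') in bonus.
suff le : #|X| <= chosen e c.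
  apply: leq_trans bonus; rewrite leq_mul2l; apply/orP; right.
  by rewrite leq_add2l leq_mul2l le orbT.
rewrite /chosen -sum1_card.
have : \sum_(i in X) 1 <= \sum_(i in X) \sum_(1 <= u < c.+1) (nu i == f' u).
  apply: leq_sum => i iX; have [iC _] := HX _ iX.
  have /segP[u /andP[u1' uc] E] : nu i \in seg f' 1 c.
    by move: iC; rewrite Cf' => /segP[n _ ->]; apply: (mem_seg_full ft').
  rewrite (bigD1_seq u) /= ?iota_uniq ?mem_index_iota ?E ?eqxx //; last by rewrite u1' -add1n.
move/leq_trans; apply; rewrite exchange_big /=; apply: leq_sum => u _.
case E: (e u) => [i|] /=.
  have [iX Ei] := eP _ _ E; rewrite (bigD1 i) //= Ei eqxx big1 // => j /andP[jX ji].
  by case: eqP => // Ej; move: ji; rewrite (inj j i) ?eqxx // Ej Ei.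
rewrite big1 // => i iX; case: eqP => // Ei; by rewrite (eS _ i) in E.
Qed.

End SmallCycle.

(** Here t is [trivial_nbrs], p is [codeg] and q the length of the path. A positive excess e of t +
    p over r - 1 forces 2p > r, hence p <= q and 2e + r <= 2q: the path is long enough to pay. *)
Lemma excess_bound r t p q : 1 < r -> 2 * t.+1 <= r -> 2 * p <= r \/ (p <= q /\ p < r) ->
  r.+1 * (t + p) <= r * q + r.+1 * r.-1.
Proof.
move=> r1 tr pq; case: (leqP (t + p) r.-1) => le.
  by apply: leq_trans (leq_addl _ _); rewrite leq_mul2l le orbT.
have [e E] : exists e, t + p = r.-1 + e by exists (t + p - r.-1); lia.
have [e1 e2] : 2 * e + r <= 2 * q /\ 2 * e <= r by lia.
by rewrite E; clear -e1 e2; nia.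
Qed.

(** At the doubled rate 2r per vertex, a path whose tip has many neighbours off C also pays r(r +
    1), the price of a missing representative. *)
Lemma excess_bound_full r t p q m : 1 < r -> 2 * t.+1 <= r -> 2 * p <= r \/ (p <= q /\ p < r) ->
  r + 3 <= 2 * m -> m <= p -> r.+1 * (t + p) + r * r.+1 <= 2 * r * q + r.+1 * r.-1.
Proof.
move=> r1 tr pq rm mp; have [pq1 pr] : p <= q /\ p < r by lia.
have q3 : r + 3 <= 2 * q by lia.
have h1 : r * (r + 3) <= r * (2 * q) by rewrite leq_mul2l q3 orbT.
case: (leqP (t + p) r.-1) => le.
  have : r.+1 * (t + p) <= r.+1 * r.-1 by rewrite leq_mul2l le orbT.
  by move: h1; clear; lia.
have [e E] : exists e, t + p = r.-1 + e by exists (t + p - r.-1); lia.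
have e1 : 2 * e + r <= 2 * q by lia.
have h2 : r * (2 * e + r) <= r * (2 * q) by rewrite leq_mul2l e1 orbT.
rewrite E mulnDr; have e0 : 0 < e by lia.
case: (leqP e 1) => e2.
  have -> : e = 1 by lia.
  by move: h1; clear -r1; nia.
suff : r.+1 * e + r * r.+1 <= r * (2 * q) by clear; lia.
apply: leq_trans h2; clear -r1 e2; nia.
Qed.

Section SmallCycle.
Variables (G : sgraph) (C : {set G}) (f g : nat -> G) (c r k m : nat).
Local Notation adj := (@adj G).
Hypothesis ft : traversal f c.
Hypothesis fmax : forall s : seq G, 1 < size s -> uniq s -> cycle adj s -> size s <= c.
Hypothesis Cf : forall v, (v \in C) = (v \in seg f 0 c).
Hypothesis gt : traversal g r.
Hypothesis gC : forall i, g i \notin C.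
Hypothesis gmax : forall s : seq G, 1 < size s -> uniq s -> cycle adj s ->
  all (fun v => v \notin C) s -> size s <= r.
Hypothesis res : resists G k.
Hypothesis degd : forall v : G, m + k <= (degree v).+1.
Hypothesis k2 : 1 < k.
Hypothesis km : k <= m.
Hypothesis kr : k <= r.
Hypothesis rk : r <= m \/ r + 3 <= 2 * k.

Lemma small_cycle_bound : k.+1 * m.+1 <= (gorder G).+1.
Proof.
have r1 := trav_gt1 gt.
have cardC : #|C| = c.
  have := uniq_seg ft 0 (leqnn c); move/card_uniqP; rewrite size_seg => cE.
  by rewrite -[RHS]cE; apply: eq_card => z; rewrite Cf.
have rc : r <= c.
  rewrite -(size_seg g 0 r); apply: fmax; rewrite ?size_seg ?(uniq_seg gt) //.
  have E : r = r.-1.+1 by move: r1; clear; lia.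
  have := walk_seg gt 0 r.-1; rewrite -E => /walk_cycle; apply.
  case: gt => _ ga gp _; have gr : g r = g 0 by rewrite -[X in g X = _]add0n gp.
  by have := ga r.-1; rewrite -E gr add0n.
have kC : k <= #|C| by rewrite cardC (leq_trans kr rc).
have [Q [eQ wQ tc pc]] := maximal_extension gt gC res kr kC.
have ext := sum_size_extension gt gC eQ; rewrite cardC in ext.
pose q i := size (Q i); pose ph := codeg C g Q; pose t := trivial_nbrs g Q.
pose W := proper_ext Q; pose T := [set i | Q i == [::]].
pose S := \sum_i cdeg C g Q i.
have cTW : #|T| + #|W| = r.
  rewrite -[RHS]card_ord -(cardsC T); congr (_ + _).
  by apply: eq_card => i; rewrite !in_set.
have sumph : \sum_i ph i <= #|T| * r.-1 + \sum_(j in W) (t j + ph j).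
  exact: (sum_codeg tc).
have Wb j : j \in W -> 2 * (t j).+1 <= r /\ (2 * ph j <= r \/ (ph j <= q j /\ ph j < r)).
  rewrite in_set => Qj; split; first exact: (trivial_nbrs_bound gt gC gmax eQ).
  exact: (codeg_proper gt gC gmax eQ pc).
have sumq : \sum_i q i = \sum_(j in W) q j.
  rewrite (bigID (mem W)) /= [X in _ + X]big1 ?addn0 // => i.
  by rewrite in_set negbK => /eqP E; rewrite /q E.
have dsum i : m + k <= (cdeg C g Q i + ph i).+1 by rewrite -deg_tip.
have Sph : r * (m + k).-1 <= S + \sum_i ph i.
  rewrite /S -big_split /= -[X in X * _](card_ord r) -sum_nat_const; apply: leq_sum => i _.
  by have := dsum i; clear; lia.
have phW j : j \in W -> ph j < r.
  by move=> /Wb[_ [|[_ //]]]; move: r1; clear; lia.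
(* A proper tip has fewer than r neighbours off C. Without proper paths there are no feet, so a
   trivial tip has at most r - 1 as well. *)
have big_cdeg : exists i, m + k <= cdeg C g Q i + r.
  case: (set_0Vmem W) => [W0|[j jW]]; last by exists j; have := dsum j; have := phW j jW; clear; lia.
  have r0 : 0 < r by move: r1; clear; lia.
  pose i := Ordinal r0; exists i.
  have no j : Q j = [::].
    by apply/eqP/negPn/negP => Qj; have : j \in W by [rewrite in_set]; rewrite W0 in_set0.
  have : ph i <= r.-1.
    apply: leq_trans (codeg_trivial tc (no i)) _; rewrite [X in _ + X](_ : _ = 0) ?addn0 //.
    by apply/eqP; rewrite cards_eq0; apply/eqP/setP => j; rewrite in_set in_set0 no.
  by have := dsum i; move: r1; clear; lia.
case: (leqP r m) => rm.
  have : r.+1 * S <= r * c.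
    apply: (cdeg_sum_bound gt gC eQ ft fmax Cf); have [i ci] := big_cdeg.
    by exists i; move: ci rm k2; clear; lia.
  have : r.+1 * \sum_(j in W) (t j + ph j) <= r * \sum_(j in W) q j + #|W| * (r.+1 * r.-1).
    rewrite !big_distrr /= -sum_nat_const -big_split /=; apply: leq_sum => j /Wb[b1 b2].
    exact: excess_bound.
  move: ext sumph Sph cTW; rewrite sumq.
  move: (\sum_(j in W) _) (\sum_(j in W) _) (\sum_i _) S #|T| #|W| (gorder G) => X Y P S' a b n.
  move=> ext sumph Sph cTW h1 h2.
  have h3 : r.+1 * P <= r.+1 * (a * r.-1 + X) by rewrite leq_mul2l sumph orbT.
  have h4 : r.+1 * (r * (m + k).-1) <= r.+1 * (S' + P) by rewrite leq_mul2l Sph orbT.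
  have h5 : (a + b) * (r.+1 * r.-1) = r * (r.+1 * r.-1) by rewrite cTW.
  have h6 : r * (r.+1 * (m + k - r)) <= r * (c + Y).
    have E : (m + k).-1 = r.-1 + (m + k - r) by move: rm k2 r1; clear; lia.
    rewrite E in h4; move: (r.-1) (m + k - r) h1 h2 h3 h4 h5 => r' x; clear; nia.
  have {}h6 : r.+1 * (m + k - r) <= c + Y by move: h6; rewrite leq_mul2l; move: r1; clear; case: r.
  (* In these terms the bound obtained for n + 1 exceeds (k + 1)(m + 1) by x * y. *)
  have [x [y [E1 E2]]] : exists x y, r = k + x /\ m = r + y by exists (r - k), (m - r); move: kr rm; clear; lia.
  move: ext h6; rewrite (_ : m + k - r = k + y); last by move: E1 E2; clear; lia.
  by rewrite E2 E1; clear; nia.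
have rk3 : r + 3 <= 2 * k by case: rk => //; move: rm; clear; lia.
pose B := [set j in W | m <= ph j].
have [X0 [mu [HX0 iX0 kX0]]] := wQ.
have rep0 : representatives C g Q X0 mu.
  by split=> // i /HX0[Qi mC a]; split=> //; rewrite /tip Qi.
have [s [X [sX rX] Xs] smax] : exists2 s,
    (exists2 X : {set 'I_r}, X0 \subset X /\ (exists nu, representatives C g Q X nu) & #|X| = s) &
    forall s', (exists2 X : {set 'I_r}, X0 \subset X /\ (exists nu, representatives C g Q X nu) & #|X| = s') -> s' <= s.
  apply: (@exists_maxP _ r); first by exists #|X0|; exists X0 => //; split=> //; exists mu.
  by move=> s' [X _ <-]; rewrite -[X in _ <= X]card_ord max_card.
have full i : i \notin X -> cdeg C g Q i <= #|X|.
  move=> iX; rewrite leqNgt; apply/negP => lt; have [nu rnu] := rX.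
  have [nu' rnu'] := representatives_extend rnu iX lt.
  have : #|i |: X| <= s.
    by apply: smax; exists (i |: X) => //; split; [exact: subset_trans sX (subsetUr _ _)|exists nu'].
  by rewrite cardsU1 iX Xs ltnn.
(* If this fails, a proper position outside [B] has at least k > |X| neighbours on C, so it lies in
   [X] by maximality. Then [X] contains all of these and [X0], which is too many because [Q] is well
   attached. *)
have kX : k <= #|X| + #|B|.
  rewrite leqNgt; apply/negP => lt.
  have sub : X0 :|: (W :\: B) \subset X.
    rewrite subUset sX /=; apply/subsetP => j; rewrite in_setD => /andP[jB jW].
    apply/negPn/negP => jX; have := leq_ltn_trans (full _ jX) (leq_ltn_trans (leq_addr _ _) lt).
    have := dsum j; move: jB; rewrite in_set jW /= -ltnNge; clear; lia.
  have dj : [disjoint X0 & W :\: B].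
    rewrite -setI_eq0; apply/eqP/setP => j; rewrite in_set0 in_setI in_setD; apply/negbTE/negP.
    by move=> /and3P[/HX0[Qj _ _] _]; rewrite in_set Qj.
  have hX : #|X0| + #|W :\: B| <= #|X|.
    by move: dj (subset_leq_card sub); rewrite -(leq_card_setU _ _).2 => /eqP ->.
  have hW : #|W| <= #|B| + #|W :\: B|.
    by rewrite -{1}(cardsID B W) leq_add2r subset_leq_card // subsetIr.
  move: lt; rewrite ltnNge => /negP; apply; apply: leq_trans kX0 _.
  apply: leq_trans (leq_add hW (leqnn _)) _; rewrite -addnA addnC leq_add2r addnC; exact: hX.
(* Otherwise some tip of [B] outside [X] has at most one neighbour on C and at most r - 1 off it,
   against m + k >= 2k >= r + 3. *)
have BX : 1 < #|X|.
  rewrite ltnNge; apply/negP => X1.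
  have [j jB jX] : exists2 j, j \in B & j \notin X.
    apply: NNPP => N; have BleX : #|B| <= #|X|.
      by apply: subset_leq_card; apply/subsetP => j jB; apply/negPn/negP => jX; apply: N; exists j.
    have := leq_trans kX (leq_add X1 (leq_trans BleX X1)).
    by move: rk3 rm km; clear; lia.
  have := leq_trans (full _ jX) X1.
  have := dsum j; have := phW j; move: jB; rewrite in_set => /andP[jW _] /(_ jW).
  by move: rk3 km; clear; lia.
have [nu rnu] := rX.
have := cdeg_sum_bonus gt gC eQ ft fmax Cf rnu BX; rewrite -/S.
have : r.+1 * \sum_(j in W) (t j + ph j) + #|B| * (r * r.+1)
    <= 2 * r * \sum_(j in W) q j + #|W| * (r.+1 * r.-1).
  have -> : #|B| * (r * r.+1) = \sum_(j in W) (if m <= ph j then r * r.+1 else 0).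
    by rewrite -big_mkcondr /= sum_nat_const; congr (_ * _); apply: eq_card => j; rewrite in_set.
  rewrite !big_distrr /= -sum_nat_const -!big_split /=; apply: leq_sum => j /Wb[b1 b2].
  case: (leqP m (ph j)) => mj.
    by apply: (@excess_bound_full _ _ _ _ m) => //; move: rk3 km; clear; lia.
  rewrite addn0; apply: leq_trans (excess_bound r1 b1 b2) _; rewrite leq_add2r leq_mul2r.
  by rewrite leq_pmull ?orbT.
move: ext sumph Sph cTW kX; rewrite sumq.
move: (\sum_(j in W) _) (\sum_(j in W) _) (\sum_i _) S #|T| #|W| #|X| #|B| (gorder G) => Z Y P S' a b x' be n.
move=> ext sumph Sph cTW kX h1 h2.
have h3 : r.+1 * P <= r.+1 * (a * r.-1 + Z) by rewrite leq_mul2l sumph orbT.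
have h4 : r.+1 * (r * (m + k).-1) <= r.+1 * (S' + P) by rewrite leq_mul2l Sph orbT.
have h5 : (a + b) * (r.+1 * r.-1) = r * (r.+1 * r.-1) by rewrite cTW.
have h7 : r * r.+1 * k <= r * r.+1 * (x' + be) by rewrite leq_mul2l kX orbT.
have h6 : r * (r.+1 * (m + k - r + k)) <= r * (2 * (c + Y)).
  have E : (m + k).-1 = r.-1 + (m + k - r) by move: rm rk3 km k2 r1; clear; lia.
  rewrite E in h4; move: (r.-1) (m + k - r) h1 h2 h3 h4 h5 h7 => r' x; clear; nia.
have {}h6 : r.+1 * (m + k - r + k) <= 2 * (c + Y) by move: h6; rewrite leq_mul2l; move: r1; clear; case: r.
(* In these terms the bound obtained for 2(n + 1) exceeds 2(k + 1)(m + 1) by j * (y + 4). *)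
have [j [y [E1 E2]]] : exists j y, r = m + j /\ 2 * k = m + j + 3 + y.
  by exists (r - m), (2 * k - r - 3); move: rk3 rm; clear; lia.
have [w Ew] : exists w, k = j + w by exists (k - j); move: E2 E1 rk3 km; clear; lia.
move: ext h6; rewrite (_ : m + k - r + k = w + k); last by move: E1 Ew; clear; lia.
rewrite E1 Ew in E2 *; move: E2; clear; nia.
Qed.

End SmallCycle.

(** * Conclusion *)

Lemma leq_bigmin (I : finType) (P : pred I) (F : I -> nat) x0 i : P i ->
  \big[minn/x0]_(j | P j) F j <= F i.
Proof.
move=> Pi; elim: (index_enum I) (mem_index_enum i) => // a s IH; rewrite inE => /orP[/eqP<-|/IH le].
  by rewrite big_cons Pi geq_minl.
rewrite big_cons; case: ifP => // _; apply: leq_trans le; exact: geq_minr.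
Qed.

Lemma min_degree_le (G : sgraph) (v : G) : min_degree G <= degree v.
Proof. exact: leq_bigmin. Qed.

Lemma resists_connectivity (G : sgraph) k : k <= connectivity G -> resists G k.
Proof.
move=> kc S lS x y xS yS.
have : connected (del_vertices S).
  apply/negPn/negP => dc; have := leq_trans kc (@leq_bigmin _ _ (fun S : {set G} => #|S|) #|G| S _).
  by rewrite dc => /(_ isT); rewrite leqNgt lS.
move=> /forallP/(_ (Sub x xS))/forallP/(_ (Sub y yS))/connectP[p pp lp].
apply/connectP; exists [seq val z | z <- p]; last first.
  by rewrite -[x]/(val (Sub x xS : {z : G | z \notin S})) last_map -lp.
rewrite -[x]/(val (Sub x xS : {z : G | z \notin S})) path_map; apply: sub_path pp => a b.
by move=> /= ab; rewrite (valP a) (valP b) !andbT.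
Qed.

Lemma lift_seq (G : sgraph) (S : {set G}) (s : seq G) : all (fun v => v \notin S) s ->
  exists t : seq (del_vertices S), [seq val z | z <- t] = s.
Proof.
elim: s => [|a s IH] /= => [_|/andP[aS /IH[t <-]]]; first by exists [::].
by exists (Sub a aS :: t).
Qed.

Lemma is_cycle_val (G : sgraph) (S : {set G}) (t : seq (del_vertices S)) :
  is_cycle t = is_cycle [seq val z | z <- t].
Proof.
rewrite /is_cycle size_map map_inj_uniq; last exact: val_inj.
by rewrite cycle_map.
Qed.

Lemma circumference_attained (G : sgraph) : 0 < circumference G ->
  exists2 s : seq G, is_cycle s & size s = circumference G.
Proof.
have : circumference G = 0 \/ exists2 s : seq G, is_cycle s & size s = circumference G.
  rewrite /circumference; elim/big_ind: _ => [|a b [->|Ha] [->|Hb]|k /existsP[s cs]].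
  - by left.
  - by left.
  - by rewrite max0n; right.
  - by rewrite maxn0; right.
  - by right; rewrite /maxn; case: ifP.
  - by right; exists s; rewrite ?size_tuple.
by case=> // ->.
Qed.

Lemma size_le_circumference (G : sgraph) (s : seq G) : uniq s -> is_cycle s ->
  size s <= circumference G.
Proof.
move=> us cs; have lt : size s < #|G|.+1 by rewrite ltnS -(card_uniqP us) max_card.
have Ps : [exists t : (Ordinal lt).-tuple G, is_cycle t] by apply/existsP; exists (in_tuple s).
exact: (@leq_bigmax_cond _ (fun n : 'I_#|G|.+1 => [exists t : n.-tuple G, is_cycle t])
  (fun n => val n) _ Ps).
Qed.

Lemma circumference_off_longest (G : sgraph) (C : seq G) (k m : nat) :
  is_longest_cycle C -> 0 < k <= m -> (forall v : G, m + k <= (degree v).+1) ->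
  resists G k -> gorder G + 2 <= k.+1 * m.+1 ->
  circumference (del_vertices [set x in C]) < k.
Proof.
move=> [cC maxC] /andP[k0 km] degd res nkm; rewrite ltnNge; apply/negP => kr.
set r := circumference _ in kr.
have maxC2 s : 1 < size s -> uniq s -> cycle (@adj G) s -> size s <= size C.
  by move=> s1 us cs; apply: maxC; rewrite /is_cycle s1 us cs orbT.
have C0 : 0 < size C by move: cC; rewrite /is_cycle => /orP[/eqP->|/and3P[/ltnW]].
(* A single vertex counts as a cycle, but degrees are positive because m + k >= 2, and an edge is a
   cycle of order 2. *)
have C2 : 1 < size C.
  case: C C0 {cC maxC r kr} maxC2 => // x C' _ maxC2.
  have /card_gt0P[y] : 0 < #|[set y | adj x y]|.
    by rewrite -/(degree x); have := degd x; move: k0 km; clear; lia.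
  rewrite inE => xy; apply: (maxC2 [:: x; y]) => //=; last by rewrite xy adj_sym xy.
  by rewrite inE andbT; apply: contraTneq xy => ->; rewrite adj_irr.
have [uC ccC] : uniq C /\ cycle (@adj G) C.
  move: cC; rewrite /is_cycle => /orP[/eqP E|/and3P[]//]; by rewrite E in C2.
have [f ft fC] := traversal_seq C2 uC ccC.
have Cf v : (v \in [set x in C]) = (v \in seg f 0 (size C)) by rewrite inE fC.
have r0 : 0 < r by apply: leq_trans k0 kr.
have [sD cD sDr] := circumference_attained r0.
pose D := [seq val z | z <- sD].
have cD' : is_cycle D by rewrite -is_cycle_val.
have Dr : size D = r by rewrite size_map.
have DC v : v \in D -> v \notin [set x in C] by move=> /mapP[z _ ->]; apply: (valP z).
have rC : r <= size C by rewrite -Dr; apply: maxC.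
have gmax s : 1 < size s -> uniq s -> cycle (@adj G) s ->
    all (fun v => v \notin [set x in C]) s -> size s <= r.
  move=> s1 us cs /lift_seq[t E]; rewrite -E size_map.
  apply: size_le_circumference; first by rewrite -(map_inj_uniq val_inj) E.
  by rewrite is_cycle_val E /is_cycle s1 us cs orbT.
have degd' (v : G) : m + k.-1 <= degree v by have := degd v; move: k0; clear; lia.
have part2 (U : {set G}) : (forall v, v \in U -> v \notin [set x in C]) -> linked k U ->
    k <= #|U| -> k = 1 \/ k < #|U| -> False.
  move=> UC lU kU kU'.
  have Uoff i : f i \notin U by apply/negP => /UC; rewrite Cf mem_seg_full.
  (* With d = m + k - 1 the resulting inequality rearranges to (k + 1)(m + 1) <= n + 1. *)
  have := linked_degree_bound ft maxC2 res k0 (leq_trans kr rC) degd' Uoff lU kU kU'.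
  move: nkm k0; move: (gorder G) => n; clear; case: k => // k'; clear => /=; nia.
case: (ltngtP r 1) => [|r2|r1]; first by rewrite ltnNge r0.
  have [uD ccD] : uniq D /\ cycle (@adj G) D.
    move: cD'; rewrite /is_cycle => /orP[/eqP E|/and3P[]//]; by rewrite Dr in E; rewrite E in r2.
  have D2 : 1 < size D by rewrite Dr.
  have [g gt gD] := traversal_seq D2 uD ccD; rewrite Dr in gt gD.
  have gC i : g i \notin [set x in C] by apply: DC; rewrite gD mem_seg_full.
  have cardD : #|[set v in D]| = r.
    by rewrite -Dr -(card_uniqP uD); apply: eq_card => v; rewrite inE.
  (* The longer arc between two vertices of D has at least r / 2 + 1 vertices, so [2 * k <= r + 2]
     makes V(D) linked, and [k < r] leaves a vertex for [h]. If this fails with k > 1, then r + 3 <=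
     2k or r = k <= m. *)
  case: (boolP ((k == 1) || ((2 * k <= r + 2) && (k < r)))) => [big|small].
    apply: (part2 [set v in D]).
    - by move=> v; rewrite inE; apply: DC.
    - move=> u v; rewrite !inE !gD => /segP[i /andP[_ ir] ->] /segP[j /andP[_ jr] ->] uv.
      rewrite add0n in ir jr; have ij : Ordinal ir != Ordinal jr by apply: contra uv => /eqP[->].
      have [s ws [us sg rs]] := long_arc gt ij; exists s => //; split=> //.
        by move=> w /sg ws'; rewrite inE gD.
      have [_] := cdist_bound ij; have := walk_size ws; move: rs big; clear; lia.
    - by rewrite cardD.
    - by rewrite cardD; move: big; clear; lia.
  have k2 : 1 < k by move: small k0; clear; lia.
  have rk : r <= m \/ r + 3 <= 2 * k by move: small kr km; clear; lia.
  have := small_cycle_bound ft maxC2 Cf gt gC gmax res degd k2 km kr rk.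
  by move: nkm; clear; lia.
have k1 : k = 1 by move: kr k0; rewrite r1; clear; lia.
have [v vD] : exists v, v \in D by case: (D) Dr => [|v s] Dr; [rewrite -Dr in r1|exists v; rewrite inE eqxx].
apply: (part2 [set v]).
- by move=> u; rewrite inE => /eqP->; apply: DC.
- by move=> u w; rewrite !inE => /eqP-> /eqP->; rewrite eqxx.
- by rewrite cards1 k1.
- by left.
Qed.

Section RationalCondition.
Import Order.TTheory GRing.Theory Num.Theory.

Lemma degree_condition_nat (n l d : nat) : l <= d ->
  ((n%:R + 2) / (l%:R + 1) + l%:R - 2 <= d%:R :> rat)%R -> n + 2 <= l.+1 * (d - l + 2).
Proof.
move=> ld hd; have l0 : (0 < l%:R + 1 :> rat)%R by rewrite natr1 ltr0n.
have : ((n%:R + 2) / (l%:R + 1) <= (d - l + 2)%:R :> rat)%R.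
  rewrite natrD natrB //; move: hd; rewrite lerBlDr -lerBrDr.
  by move/le_trans; apply; rewrite addrAC.
by rewrite ler_pdivrMr // -natrD natr1 -natrM ler_nat mulnC.
Qed.

End RationalCondition.

Theorem theorem5 (G : sgraph) (C : seq G) (lambda : nat)
  (hC : is_longest_cycle C)
  (hlambda : 1 <= lambda <= min_degree G)
  (hkappa : minn lambda (min_degree G - lambda + 1) <= connectivity G)
  (hdelta : ((#|G|%:R + 2) / (lambda%:R + 1) + lambda%:R - 2
             <= (min_degree G)%:R :> rat)%R) :
  circumference (del_vertices [set x in C]) <= min_degree G - lambda.
Proof.
set d := min_degree G in hlambda hkappa hdelta *.
have /andP[l1 ld] := hlambda.
have nd : gorder G + 2 <= lambda.+1 * (d - lambda + 2).
  exact: degree_condition_nat ld hdelta.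
pose k := minn lambda (d - lambda + 1); pose m := maxn lambda (d - lambda + 1).
have km : 0 < k <= m by rewrite /k /m; move: l1; clear; lia.
have kmd : m + k = d.+1 by rewrite /k /m; move: ld; clear; lia.
have degd (v : G) : m + k <= (degree v).+1 by rewrite kmd ltnS min_degree_le.
(* The factors [lambda.+1] and [d - lambda + 2] are k + 1 and m + 1 in one order or the other. *)
have nkm : gorder G + 2 <= k.+1 * m.+1.
  apply: leq_trans nd _; rewrite /k /m /minn /maxn; case: ifP => _; rewrite ?addn1 ?addn2 //.
  by rewrite mulnC.
have := circumference_off_longest hC km degd (resists_connectivity hkappa) nkm.
by rewrite /k; clear; lia.
Qed.
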